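(* Let $\dim Q=2$. Consider third-order Euler–Poisson (variational) equations $$\mathbf A\,\mathbf v''+(\mathbf v'\cdot\partial_{\mathbf v})\mathbf A\,\mathbf v'+\mathbf B\,\mathbf v'+\mathbf c=\mathbf 0$$ for curves $t\mapsto\mathbf x(t)\in\mathbb R^2$ (with $\mathbf v=d\mathbf x/dt$, $\mathbf v'=d\mathbf v/dt$, $\mathbf v''=d\mathbf v'/dt$), where the skew-symmetric matrix $\mathbf A$ (not identically zero), the symmetric matrix $\mathbf B$ and the column $\mathbf c$ are smooth functions of $t,\mathbf x,\mathbf v$ on the domain $1+\mathbf v\cdot\mathbf v>0$ and satisfy the variationality system (V) of the context. Suppose the equation is Poincaré-invariant in the sense of the context. Then, up to an overall nonzero constant factor, the equation is $$-\frac{*\mathbf v''}{(1+\mathbf v\cdot\mathbf v)^{3/2}}+3\,\frac{*\mathbf v'}{(1+\mathbf v\cdot\mathbf v)^{5/2}}(\mathbf v\cdot\mathbf v')-\frac{\mu}{(1+\mathbf v\cdot\mathbf v)^{3/2}}\bigl((1+\mathbf v\cdot\mathbf v)\,\mathbf v'-(\mathbf v'\cdot\mathbf v)\,\mathbf v\bigr)=\mathbf 0$$ for some constant $\mu\in\mathbb R$ (in the last term the vectors are taken with lowered indices). Conversely, for every $\mu\in\mathbb R$ this equation is of the form $\mathbf A\,\mathbf v''+(\mathbf v'\cdot\partial_{\mathbf v})\mathbf A\,\mathbf v'+\mathbf B\,\mathbf v'+\mathbf c=\mathbf 0$ with $\mathbf A$ skew-symmetric and not identically zero, $\mathbf B$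 symmetric and $\mathbf c$ a column, all smooth on the domain $1+\mathbf v\cdot\mathbf v>0$, satisfies (V), and is Poincaré-invariant. Thus the invariant Euler–Poisson equation exists and is unique up to the single scalar parameter $\mu$.
   Context: Metric: space-time has the constant metric $g=\mathrm{diag}(1,\eta_1,\eta_2)$, $\eta_i=\pm1$, in coordinates $(t,\mathsf x^1,\mathsf x^2)$. Indices are lowered by $g$: $\mathsf w_i=\eta_i\mathsf w^i$ (no sum); $\mathbf w\cdot\mathbf z=\mathsf w_1\mathsf z^1+\mathsf w_2\mathsf z^2$. The dual is $( *\mathbf w)_i=\epsilon_{ji}\mathsf w^j$, with $\epsilon_{12}=-\epsilon_{21}=1$, $\epsilon_{11}=\epsilon_{22}=0$. The equation has lower (covector) index: e.g. $(\mathbf A\mathbf v'')_i=\mathsf A_{ij}\mathsf v''^j$. Variationality system (V), with $\mathbf D_1=\partial_t+\mathsf v^i\partial_{\mathsf x^i}$, $[\,]$ and $(\,)$ denoting normalized antisymmetrization and symmetrization over the enclosed indices, $\partial_{\mathsf v\,i}=\partial/\partial\mathsf v^i$, $\partial_{\mathsf x\,i}=\partial/\partial\mathsf x^i$: $$\begin{aligned} &\partial_{\mathsf v[i}\mathsf A_{jl]}=0,\qquad 2\mathsf B_{[ij]}-3\mathbf D_1\mathsf A_{ij}=0,\\ &2\partial_{\mathsf v[i}\mathsf B_{j]l}-4\partial_{\mathsf x[i}\mathsf A_{j]l}+\partial_{\mathsf x\,l}\mathsf A_{ij}+2\mathbf D_1\partial_{\mathsf v\,l}\mathsf A_{ij}=0,\\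 &\partial_{\mathsf v(i}\mathsf c_{j)}-\mathbf D_1\mathsf B_{(ij)}=0,\\ &2\partial_{\mathsf v\,l}\partial_{\mathsf v[i}\mathsf c_{j]}-4\partial_{\mathsf x[i}\mathsf B_{j]l}+\mathbf D_1^2\partial_{\mathsf v\,l}\mathsf A_{ij}+6\mathbf D_1\partial_{\mathsf x[i}\mathsf A_{jl]}=0,\\ &4\partial_{\mathsf x[i}\mathsf c_{j]}-2\mathbf D_1\partial_{\mathsf v[i}\mathsf c_{j]}-\mathbf D_1^3\mathsf A_{ij}=0. \end{aligned}$$ Poincaré invariance: put $\mathbf k=(\mathbf v'\cdot\partial_{\mathbf v})\mathbf A\,\mathbf v'+\mathbf B\,\mathbf v'+\mathbf c$ and let $\boldsymbol\epsilon=\mathbf A\,d\mathbf v'+\mathbf k\,dt$, a vector-valued differential one-form in the variables $(t,\mathbf x,\mathbf v,\mathbf v')$. The equation is Poincaré-invariant if (i) (translations) $\mathbf A$ and $\mathbf k$ do not depend on $t$ and $\mathbf x$; and (ii) (Lorentz group) for every vector $\boldsymbol\pi\in\mathbb R^2$ and every $\omega\in\mathbb R$, the vector field $$\begin{aligned}X={}&-(\boldsymbol\pi\cdot\mathbf x)\partial_t+t\,\pi^i\partial_{\mathsf x^i}+\omega(\mathsf x_1\partial_{\mathsf x^2}-\mathsf x_2\partial_{\mathsf x^1})\\ &+\pi^i\partial_{\mathsf v^i}+(\boldsymbol\pi\cdot\mathbf v)\mathsf v^i\partial_{\mathsf v^i}+\omega(\mathsf v_1\partial_{\mathsf v^2}-\mathsf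 v_2\partial_{\mathsf v^1})\\ &+2(\boldsymbol\pi\cdot\mathbf v)\mathsf v'^i\partial_{\mathsf v'^i}+(\boldsymbol\pi\cdot\mathbf v')\mathsf v^i\partial_{\mathsf v'^i}+\omega(\mathsf v'_1\partial_{\mathsf v'^2}-\mathsf v'_2\partial_{\mathsf v'^1})\end{aligned}$$ admits smooth $2\times2$ matrix functions $\boldsymbol\Phi,\boldsymbol\Xi,\boldsymbol\Pi$ of $(\mathbf v,\mathbf v')$ such that the component-wise Lie derivative satisfies $$X(\boldsymbol\epsilon)=\boldsymbol\Phi\,\boldsymbol\epsilon+\boldsymbol\Xi\,(d\mathbf x-\mathbf v\,dt)+\boldsymbol\Pi\,(d\mathbf v-\mathbf v'\,dt).$$ *)

(* Defs.v *)
From mathcomp Require Import all_boot all_order all_algebra.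
From mathcomp Require Import all_classical all_reals all_analysis.

Set Implicit Arguments.
Unset Strict Implicit.
Unset Printing Implicit Defensive.

Import Order.TTheory GRing.Theory Num.Theory.
Import numFieldNormedType.Exports.

Local Open Scope classical_set_scope.
Local Open Scope ring_scope.

Section Smoothness.
Context {R : realType} {E : normedModType R}.

Fixpoint differentiable_upto (n : nat) (U : set E) (f : E -> R) : Prop :=
  if n is m.+1 then
    (forall p, U p -> differentiable f p) /\
    (forall w : E, differentiable_upto m U (fun p => 'D_w f p))
  else True.

(* C^oo on U. Intended for U open and E finite dimensional: there, every
   iterated directional derivative of f is (Frechet) differentiable on U iff f
   is infinitely differentiable on U. The values of f outside U are
   irrelevant. *)
Definition smooth (U : set E) (f : E -> R) : Prop :=
  forall n, differentiable_upto n U f.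

(* A one-form is given by its value theta p w on a tangent vector w at p.
   Evaluating L_X theta on the constant vector field w, for which
   [X, w] = - D_w X, gives X (theta w) - theta [X, w]. *)
Definition lie_derivative (X : E -> E) (theta : E -> E -> R) : E -> E -> R :=
  fun p w => 'D_(X p) (fun q => theta q w) p + theta p ('D_w X p).

End Smoothness.

Section Metric.
Context {R : realType}.
Variable eta : 'I_2 -> R.
Implicit Types w z : 'cV[R]_2.

(* The indices 1, 2 are 0, 1 : 'I_2. Column vectors carry the contravariant
   components, except where an index has been lowered explicitly. *)
Definition lower w : 'cV[R]_2 := \col_i (eta i * w i 0).

Definition dot w z : R := \sum_i lower w i 0 * z i 0.

Definition levi_civita : 'M[R]_2 := \matrix_(i, j) ((i < j)%N%:R - (j < i)%N%:R).

Definition star w : 'cV[R]_2 := \col_i \sum_j levi_civita j i * w j 0.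

(* The linear vector field w_1 d/dw^2 - w_2 d/dw^1. *)
Definition rotation w : 'cV[R]_2 :=
  \col_i (if i == 0 then - lower w 1 0 else lower w 0 0).

End Metric.

Section JetSpaces.
Variable R : realType.

(* (t, x, v), (t, x, v, v') and (v, v'). Being vector spaces, these are also
   the types of their own tangent vectors: e.g. dt, dx, dv, dv' evaluated on
   w : jet2 are time w.1, pos w.1, vel w.1, w.2. *)
Definition jet1 : normedModType R := (R * 'cV[R]_2 * 'cV[R]_2)%type.
Definition jet2 : normedModType R := (jet1 * 'cV[R]_2)%type.
Definition velacc : normedModType R := ('cV[R]_2 * 'cV[R]_2)%type.

Definition time (p : jet1) : R := p.1.1.
Definition pos (p : jet1) : 'cV[R]_2 := p.1.2.
Definition vel (p : jet1) : 'cV[R]_2 := p.2.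

Definition e_t : jet1 := (1, 0, 0).
Definition e_x (i : 'I_2) : jet1 := (0, delta_mx i 0, 0).
Definition e_v (i : 'I_2) : jet1 := (0, 0, delta_mx i 0).

End JetSpaces.

Section EulerPoisson.
Context {R : realType}.
Variable eta : 'I_2 -> R.
Local Notation jet1 := (jet1 R).
Local Notation jet2 := (jet2 R).
Local Notation velacc := (velacc R).

Definition vdom : set 'cV[R]_2 := [set v | 0 < 1 + dot eta v v].
Definition jet1_dom : set jet1 := [set p | vdom (vel p)].
Definition jet2_dom : set jet2 := [set p | jet1_dom p.1].
Definition velacc_dom : set velacc := [set y | vdom y.1].

Definition pt (f : jet1 -> R) : jet1 -> R := fun p => 'D_(e_t R) f p.
Definition px (i : 'I_2) (f : jet1 -> R) : jet1 -> R := fun p => 'D_(e_x R i) f p.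
Definition pv (i : 'I_2) (f : jet1 -> R) : jet1 -> R := fun p => 'D_(e_v R i) f p.

(* Unlike dot, this pairing of v with d/dx involves no metric. *)
Definition D1 (f : jet1 -> R) : jet1 -> R :=
  fun p => pt f p + \sum_i vel p i 0 * px i f p.

Definition entry n (F : jet1 -> 'M[R]_(2, n)) (i : 'I_2) (j : 'I_n) : jet1 -> R :=
  fun p => F p i j.

Definition alt2 (T : 'I_2 -> 'I_2 -> R) (i j : 'I_2) : R := (T i j - T j i) / 2.
Definition sym2 (T : 'I_2 -> 'I_2 -> R) (i j : 'I_2) : R := (T i j + T j i) / 2.
Definition alt3 (T : 'I_2 -> 'I_2 -> 'I_2 -> R) (i j l : 'I_2) : R :=
  (T i j l + T j l i + T l i j - T j i l - T i l j - T l j i) / 6.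

Section Coefficients.
Variables (A B : jet1 -> 'M[R]_2) (c : jet1 -> 'cV[R]_2).

Record variational : Prop := Variational {
  variational_1 : forall p, jet1_dom p -> forall i j l,
    alt3 (fun i j l => pv i (entry A j l) p) i j l = 0;
  variational_2 : forall p, jet1_dom p -> forall i j,
    2 * alt2 (fun i j => B p i j) i j - 3 * D1 (entry A i j) p = 0;
  variational_3 : forall p, jet1_dom p -> forall i j l,
    2 * alt2 (fun i j => pv i (entry B j l) p) i j
    - 4 * alt2 (fun i j => px i (entry A j l) p) i j
    + px l (entry A i j) p + 2 * D1 (pv l (entry A i j)) p = 0;
  variational_4 : forall p, jet1_dom p -> forall i j,
    sym2 (fun i j => pv i (entry c j 0) p) i j
    - D1 (fun q => sym2 (fun i j => B q i j) i j) p = 0;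
  variational_5 : forall p, jet1_dom p -> forall i j l,
    2 * pv l (fun q => alt2 (fun i j => pv i (entry c j 0) q) i j) p
    - 4 * alt2 (fun i j => px i (entry B j l) p) i j
    + D1 (D1 (pv l (entry A i j))) p
    + 6 * D1 (fun q => alt3 (fun i j l => px i (entry A j l) q) i j l) p = 0;
  variational_6 : forall p, jet1_dom p -> forall i j,
    4 * alt2 (fun i j => px i (entry c j 0) p) i j
    - 2 * D1 (fun q => alt2 (fun i j => pv i (entry c j 0) q) i j) p
    - D1 (D1 (D1 (entry A i j))) p = 0
}.

Record euler_poisson : Prop := EulerPoisson {
  ep_smoothA : forall i j, smooth jet1_dom (entry A i j);
  ep_smoothB : forall i j, smooth jet1_dom (entry B i j);
  ep_smoothc : forall i, smooth jet1_dom (entry c i 0);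
  ep_skewA : forall p, jet1_dom p -> (A p)^T = - A p;
  ep_symB : forall p, jet1_dom p -> (B p)^T = B p;
  ep_neq0A : exists p, jet1_dom p /\ A p <> 0;
  ep_variational : variational
}.

(* (v' . d/dv) A; again no metric is involved. *)
Definition dA_along (p : jet2) : 'M[R]_2 :=
  \matrix_(i, j) \sum_l p.2 l 0 * pv l (entry A i j) p.1.

Definition kvec (p : jet2) : 'cV[R]_2 :=
  dA_along p *m p.2 + B p.1 *m p.2 + c p.1.

Definition ep_lhs (p : jet2) (v'' : 'cV[R]_2) : 'cV[R]_2 :=
  A p.1 *m v'' + dA_along p *m p.2 + B p.1 *m p.2 + c p.1.

(* A dv' + k dt. *)
Definition ep_form (p w : jet2) : 'cV[R]_2 :=
  A p.1 *m w.2 + time w.1 *: kvec p.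

Definition translation_invariant : Prop :=
  (forall t1 t2 x1 x2 v, vdom v -> A (t1, x1, v) = A (t2, x2, v)) /\
  (forall t1 t2 x1 x2 v v', vdom v ->
     kvec (t1, x1, v, v') = kvec (t2, x2, v, v')).

Definition lorentz_field (beta : 'cV[R]_2) (omega : R) (p : jet2) : jet2 :=
  let t := time p.1 in let x := pos p.1 in
  let v := vel p.1 in let v' := p.2 in
  (- dot eta beta x,
   t *: beta + omega *: rotation eta x,
   beta + dot eta beta v *: v + omega *: rotation eta v,
   (2 * dot eta beta v) *: v' + dot eta beta v' *: v + omega *: rotation eta v').

Definition lorentz_invariant : Prop :=
  forall (beta : 'cV[R]_2) (omega : R),
  exists Phi Xi Pi : velacc -> 'M[R]_2,
  [/\ forall i j, smooth velacc_dom (fun y => Phi y i j),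
      forall i j, smooth velacc_dom (fun y => Xi y i j),
      forall i j, smooth velacc_dom (fun y => Pi y i j) &
      forall p, jet2_dom p -> forall (w : jet2) (i : 'I_2),
        let y : velacc := (vel p.1, p.2) in
        lie_derivative (lorentz_field beta omega)
          (fun q u => ep_form q u i 0) p w =
        (Phi y *m ep_form p w
         + Xi y *m (pos w.1 - time w.1 *: vel p.1)
         + Pi y *m (vel w.1 - time w.1 *: p.2)) i 0].

Definition poincare_invariant : Prop :=
  translation_invariant /\ lorentz_invariant.

End Coefficients.

Definition invariant_lhs (mu : R) (v v' v'' : 'cV[R]_2) : 'cV[R]_2 :=
  let s := 1 + dot eta v v in
  - ((s `^ (3 / 2))^-1 *: star v'')
  + (3 * (s `^ (5 / 2))^-1 * dot eta v v') *: star v'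
  - (mu / s `^ (3 / 2)) *: (s *: lower eta v' - dot eta v' v *: lower eta v).

End EulerPoisson.

(* Main.v *)
(* Write A = a J with J the Levi-Civita matrix, s = 1 + v.v, and let beta_low
   be beta with its index lowered.

   Uniqueness. For every v there is a Lorentz field X (omega = 1,
   beta = - rotation v) whose velocity part vanishes at v; it acts on v' by
   M = rotation + v beta_low^T, of determinant eta_0 eta_1 s. The invariance
   condition, evaluated on the tangent vector (1, v, v', v'') with
   A v'' + k = 0, involves none of Phi, Xi, Pi and becomes polynomial in v'.
   Where a <> 0 its three homogeneous parts give
     grad a . M = - 3 a beta_low,   B M + M^T B = 0,   J M J^-1 c = 0,
   that is: s grad a = - 3 a v_low, B is a multiple of
   N = s eta - v_low v_low^T, and c = 0. Where a = 0 the fields with omega = 0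
   give grad a = 0, so the equation for grad a holds everywhere. Hence a s^(3/2) is
   constant on the star-shaped domain, and the curl condition
   d_[i B_j]l = 0 contained in (V) makes B s^(3/2) a constant multiple of N.

   Existence. For A = s^(-3/2) J, B = - mu s^(-3/2) N, c = 0, the multipliers
   are Phi = - beta_low v^T - omega rotation^T, Xi = - k beta_low^T and
   Pi = 2 (A v') beta_low^T + (beta.v') A. *)

From HB Require Import structures.
Require Import Defs.
From mathcomp Require Import all_boot all_order all_algebra.
From mathcomp Require Import all_classical all_reals all_analysis.
From mathcomp Require Import ring lra.
Import Order.TTheory GRing.Theory Num.Theory.
Import numFieldNormedType.Exports.
Local Open Scope classical_set_scope.
Local Open Scope ring_scope.

Set Implicit Arguments.
Unset Strict Implicit.
Unset Printing Implicit Defensive.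

(** * Directional derivatives and smooth functions *)

Section Calculus.
Context {R : realType} {E : normedModType R}.
Implicit Types (f g : E -> R) (p w : E) (U : set E).

(** Differentiability depends on the germ only: the small-o expansion of [f] at [p] is also one of
    [g], and uniqueness of the differential identifies the two. *)
Lemma near_eq_differentiable f g p :
  (\near p, f p = g p) -> differentiable f p -> differentiable g p.
Proof.
move=> fg df.
have fgp : f p = g p by exact: nbhs_singleton fg.
suff H : g \o shift p = cst (g p) + 'd f p +o_ 0 id.
  have dgE : 'd g p = 'd f p :> (E -> R).
    by apply: diff_unique H; exact: diff_continuous.
  by apply/diff_locallyP; rewrite dgE; split => //; exact: diff_continuous.
apply/eqaddoP => e e0.
have /eqaddoP dfo := diff_locally df; have dfe := dfo e e0.
have fgs : \forall h \near (0 : E), f (h + p) = g (h + p).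
  by move: fg; rewrite (near_shift 0 p) subr0; apply: filterS => x /=.
apply: filterS2 dfe fgs => h /=.
by rewrite !fctE /= fgp => + <-.
Qed.

(** Differentiability and value travel together, so that the derivative of a compound expression is
    one nested term of the rules below, normalized afterwards by [ring] or [field]. *)
Definition has_derivative f p w (d : R) := differentiable f p /\ 'D_w f p = d.

Lemma has_derivative_cst (c : R) p w : has_derivative (fun=> c) p w 0.
Proof. by split; [exact: differentiable_cst | exact: derive_cst]. Qed.

Lemma has_derivativeD f g p w df dg :
  has_derivative f p w df -> has_derivative g p w dg ->
  has_derivative (fun q => f q + g q) p w (df + dg).
Proof.
move=> [Df <-] [Dg <-]; split; first exact: differentiableD.
by rewrite deriveD//; exact: diff_derivable.
Qed.

Lemma has_derivativeN f p w df :
  has_derivative f p w df -> has_derivative (fun q => - f q) p w (- df).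
Proof.
move=> [Df <-]; split; first exact: differentiableN.
by rewrite deriveN//; exact: diff_derivable.
Qed.

Lemma has_derivativeM f g p w df dg :
  has_derivative f p w df -> has_derivative g p w dg ->
  has_derivative (fun q => f q * g q) p w (f p * dg + g p * df).
Proof.
move=> [Df <-] [Dg <-]; split; first exact: differentiableM.
by rewrite deriveM//; exact: diff_derivable.
Qed.

Lemma has_derivative_linear f p w : linear f -> continuous f ->
  has_derivative f p w (f w).
Proof.
move=> lf cf.
pose fL : {linear E -> R} := HB.pack f (GRing.isLinear.Build _ _ _ _ f lf).
have Df : differentiable f p by exact: (@linear_differentiable _ _ _ fL).
by split => //; rewrite deriveE// (@diff_lin _ _ _ fL).
Qed.

Lemma has_derivative_powR f p w df (a : R) : 0 < f p ->
  has_derivative f p w df ->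
  has_derivative (fun q => f q `^ a) p w (a * f p `^ (a - 1) * df).
Proof.
move=> fp [Df <-].
have [Dg Dge] := is_derive1_powR a fp.
have dg : differentiable (fun x : R => x `^ a) (f p) by exact/derivable1_diffP.
split; first exact: (differentiable_comp Df dg).
rewrite [LHS]deriveE; last exact: (differentiable_comp Df dg).
rewrite (diff_comp Df dg)/= (deriveE _ Df).
apply: (etrans (congr1 (@^~ ('d f p w)) (diff1E dg))).
by rewrite derive1E Dge; exact: mulrC.
Qed.

(** The difference quotient is exactly L + h Q. Polynomial maps into any normed module are thus
    differentiated without a prior proof of differentiability. *)
Lemma derive_quadratic (F : normedModType R) (f : E -> F) p w L Q :
  (forall h : R, f (h *: w + p) = f p + h *: L + h ^+ 2 *: Q) -> 'D_w f p = L.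
Proof.
move=> H; apply: cvg_lim; first exact: norm_hausdorff.
suff : (fun h : R => L + h *: Q) @ 0^' --> L.
  apply: cvg_trans; apply: near_eq_cvg.
  near=> h; have h0 : h != 0 by near: h; exact: nbhs_dnbhs_neq.
  rewrite /= H -[X in _ = _ *: (X - _)]addrA [f p + _]addrC addrK scalerDr !scalerA.
  by rewrite mulVf// scale1r expr2 mulKf.
rewrite -[X in _ --> X]addr0 -(scale0r Q).
apply: cvg_within_filter; apply: cvgD; first exact: cvg_cst.
by apply: cvgZr_tmp; exact: cvg_id.
Unshelve. all: by end_near. Qed.

Lemma derive_const_along (F : normedModType R) (f : E -> F) p w :
  (forall h : R, f (h *: w + p) = f p) -> 'D_w f p = 0.
Proof.
move=> H; apply: (@derive_quadratic F f p w 0 0) => h.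
by rewrite H !scaler0 !addr0.
Qed.

(** A directional derivative sees only the restriction to a line, so functions on different spaces
    can be compared. *)
Lemma eq_derive_line (E' F : normedModType R) (f : E -> F) (g : E' -> F)
    p w (q u : E') :
  (forall h : R, f (h *: w + p) = g (h *: u + q)) -> 'D_w f p = 'D_u g q.
Proof.
move=> fg; have fg0 : f p = g q by have := fg 0; rewrite !scale0r !add0r.
rewrite /derive.
have -> : (fun h => h^-1 *: ((f \o shift p) (h *: w) - f p)) =
          (fun h => h^-1 *: ((g \o shift q) (h *: u) - g q)).
  by apply/funext => h /=; rewrite fg fg0.
by [].
Qed.

Lemma eq_differentiable_upto n U f g : open U -> (forall p, U p -> f p = g p) ->
  differentiable_upto n U f -> differentiable_upto n U g.
Proof.
move=> oU; elim: n f g => //= n IH f g fg [df Df].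
have nfg p : U p -> \near p, f p = g p.
  by move=> Up; apply: filterS (open_nbhs_nbhs (conj oU Up)).
split=> [p Up|w]; first exact: near_eq_differentiable (nfg _ Up) (df p Up).
by apply: IH (Df w) => p Up; exact: near_eq_derive (nfg _ Up).
Qed.

Lemma differentiable_uptoW n U f :
  differentiable_upto n.+1 U f -> differentiable_upto n U f.
Proof. by elim: n f => //= n IH f [df Df]; split => // w; apply: IH. Qed.

Lemma smooth_differentiable U f p : smooth U f -> U p -> differentiable f p.
Proof. by move=> /(_ 1%N)[+ _]; apply. Qed.

Lemma smooth_cst U (c : R) : smooth U (fun=> c).
Proof.
move=> n; elim: n c => //= n IH c; split=> [p _|w].
  exact: differentiable_cst.
have -> : (fun p => 'D_w (fun=> c) p) = (fun=> 0 : R); last exact: IH.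
by apply/funext => p; exact: derive_cst.
Qed.

Lemma smooth_linear U f : linear f -> continuous f -> smooth U f.
Proof.
move=> lf cf [|n]//=; split=> [p _|w]; first by have [] := has_derivative_linear p 0 lf cf.
have -> : (fun p => 'D_w f p) = (fun=> f w); last exact: smooth_cst.
by apply/funext => p; have [] := has_derivative_linear p w lf cf.
Qed.

Lemma differentiable_uptoD n U f g : open U -> differentiable_upto n U f ->
  differentiable_upto n U g -> differentiable_upto n U (fun p => f p + g p).
Proof.
move=> oU; elim: n f g => //= n IH f g [df Df] [dg Dg].
split=> [p Up|w]; first exact: differentiableD (df p Up) (dg p Up).
apply: eq_differentiable_upto oU _ (IH _ _ (Df w) (Dg w)) => p Up.
by rewrite deriveD//; apply: diff_derivable; auto.
Qed.

Lemma differentiable_uptoM n U f g : open U -> differentiable_upto n U f ->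
  differentiable_upto n U g -> differentiable_upto n U (fun p => f p * g p).
Proof.
move=> oU; elim: n f g => // n IH f g df dg.
have [df0 Df] := df; have [dg0 Dg] := dg.
split=> [p Up|w]; first exact: differentiableM (df0 p Up) (dg0 p Up).
have := differentiable_uptoD oU (IH _ _ (differentiable_uptoW df) (Dg w))
                                (IH _ _ (differentiable_uptoW dg) (Df w)).
apply: eq_differentiable_upto oU _ => p Up.
by rewrite deriveM//; apply: diff_derivable; auto.
Qed.

(** The derivative a f^(a-1) f' carries another exponent, so the induction quantifies over [a]. *)
Lemma differentiable_upto_powR n U f (a : R) : open U ->
  (forall p, U p -> 0 < f p) -> differentiable_upto n U f ->
  differentiable_upto n U (fun p => f p `^ a).
Proof.
move=> oU f0; elim: n a => // n IH a df; have [df0 Df] := df.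
have D w p (Up : U p) := has_derivative_powR a (f0 p Up)
  (conj (df0 p Up) (erefl ('D_w f p))).
split=> [p Up|w]; first by have [] := D 0 p Up.
have := differentiable_uptoM oU (differentiable_uptoM oU (@smooth_cst U a n)
  (IH (a - 1) (differentiable_uptoW df))) (Df w).
by apply: eq_differentiable_upto oU _ => p Up; have [_ ->] := D w p Up.
Qed.

Lemma smoothD U f g : open U -> smooth U f -> smooth U g ->
  smooth U (fun p => f p + g p).
Proof. by move=> oU sf sg n; exact: differentiable_uptoD. Qed.

Lemma smoothM U f g : open U -> smooth U f -> smooth U g ->
  smooth U (fun p => f p * g p).
Proof. by move=> oU sf sg n; exact: differentiable_uptoM. Qed.

Lemma smoothN U f : open U -> smooth U f -> smooth U (fun p => - f p).
Proof.
move=> oU sf; have -> : (fun p => - f p) = (fun p => -1 * f p).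
  by apply/funext => p; rewrite mulN1r.
by apply: smoothM => //; exact: smooth_cst.
Qed.

Lemma smooth_powR U f (a : R) : open U -> (forall p, U p -> 0 < f p) ->
  smooth U f -> smooth U (fun p => f p `^ a).
Proof. by move=> oU f0 sf n; exact: differentiable_upto_powR. Qed.

End Calculus.

(** * Jet coordinates *)

Lemma ord2P (i : 'I_2) : i = 0 \/ i = 1.
Proof. by case: i => [[|[|//]] i]; [left|right]; exact: val_inj. Qed.

Lemma sum2E (V : nmodType) (F : 'I_2 -> V) : \sum_i F i = F 0 + F 1.
Proof.
by rewrite big_ord_recr big_ord1 /=; congr (F _ + F _); exact: val_inj.
Qed.

Lemma colP2 (R : pzRingType) (v w : 'cV[R]_2) :
  v 0 0 = w 0 0 -> v 1 0 = w 1 0 -> v = w.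
Proof.
by move=> e0 e1; apply/colP => i; case: (ord2P i) => ->.
Qed.

Section Coordinates.
Context {R : realType} (eta : 'I_2 -> R).
Implicit Types v : 'cV[R]_2.

Lemma dotE v v' :
  dot eta v v' = eta 0 * v 0 0 * v' 0 0 + eta 1 * v 1 0 * v' 1 0.
Proof. by rewrite /dot sum2E !mxE. Qed.

Section Pullback.
Context {E : normedModType R} (T : E -> 'cV[R]_2).
Hypotheses (linT : linear T) (contT : continuous T).

Let lin_coord i : linear (fun p => T p i 0).
Proof. by move=> k u v; rewrite linT !mxE. Qed.

Let cont_coord i : continuous (fun p => T p i 0).
Proof.
by move=> p; apply: (@continuous_comp _ _ _ T (fun M : 'cV[R]_2 => M i 0));
  [exact: contT | exact: coord_continuous].
Qed.

(** [T] stands for the velocity and acceleration projections of the various jet spaces; one set of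
    rules serves them all. *)
Lemma has_derivative_coord i p w :
  has_derivative (fun q => T q i 0) p w (T w i 0).
Proof. exact: has_derivative_linear. Qed.

Lemma smooth_coord U i : smooth U (fun q => T q i 0).
Proof. exact: smooth_linear. Qed.

End Pullback.

Section DotPullback.
Context {E : normedModType R} (T S : E -> 'cV[R]_2).
Hypotheses (linT : linear T) (contT : continuous T).
Hypotheses (linS : linear S) (contS : continuous S).

Lemma smooth_dot U : open U -> smooth U (fun q => dot eta (T q) (S q)).
Proof.
move=> oU; under eq_fun do rewrite dotE.
do ![apply: smoothD => //|apply: smoothM => //|exact: smooth_cst
    |exact: smooth_coord linT contT _ _|exact: smooth_coord linS contS _ _].
Qed.

Lemma has_derivative_dot p w : has_derivative (fun q => dot eta (T q) (S q)) p w
  (dot eta (T w) (S p) + dot eta (T p) (S w)).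
Proof.
under eq_fun do rewrite dotE.
have DT i := has_derivative_coord linT contT i p w.
have DS i := has_derivative_coord linS contS i p w.
have C c := has_derivative_cst c p w.
have := has_derivativeD
  (has_derivativeM (has_derivativeM (C (eta 0)) (DT 0)) (DS 0))
  (has_derivativeM (has_derivativeM (C (eta 1)) (DT 1)) (DS 1)).
by congr has_derivative; rewrite !dotE; ring.
Qed.

End DotPullback.

Section NormPullback.
Context {E : normedModType R} (T : E -> 'cV[R]_2).
Hypotheses (linT : linear T) (contT : continuous T).

Lemma smooth_norm_powR U (a : R) : open U -> (forall p, U p -> vdom eta (T p)) ->
  smooth U (fun q => (1 + dot eta (T q) (T q)) `^ a).
Proof.
move=> oU sU; apply: smooth_powR => //; apply: smoothD => //.
  exact: smooth_cst.
exact: smooth_dot.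
Qed.

Lemma has_derivative_norm_powR p w (a : R) : vdom eta (T p) ->
  has_derivative (fun q => (1 + dot eta (T q) (T q)) `^ a) p w
    (2 * a * (1 + dot eta (T p) (T p)) `^ (a - 1) * dot eta (T p) (T w)).
Proof.
move=> Tp; have := @has_derivative_powR _ _ (fun q => 1 + dot eta (T q) (T q)) p w _ a Tp
  (has_derivativeD
  (has_derivative_cst 1 p w) (has_derivative_dot linT contT linT contT p w)).
by congr has_derivative; rewrite !dotE; ring.
Qed.

Lemma open_vdom : open [set p | vdom eta (T p)].
Proof.
have H p : differentiable (fun q => 1 + dot eta (T q) (T q)) p.
  by have [] := has_derivativeD (has_derivative_cst 1 p 0)
    (has_derivative_dot linT contT linT contT p 0).
have := @open_comp _ _ (fun q => 1 + dot eta (T q) (T q)) [set x : R | 0 < x].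
apply; last exact: open_gt.
by move=> p _; exact: differentiable_continuous.
Qed.

End NormPullback.

Lemma linear_vel : linear (@vel R). Proof. by []. Qed.
Lemma continuous_vel : continuous (@vel R).
Proof. by move=> p; exact: cvg_snd. Qed.
Lemma linear_vel2 : linear (fun p : jet2 R => vel p.1). Proof. by []. Qed.
Lemma continuous_vel2 : continuous (fun p : jet2 R => vel p.1).
Proof.
move=> p; apply: (@continuous_comp _ _ _ fst (@vel R)); first exact: cvg_fst.
exact: continuous_vel.
Qed.
Lemma linear_acc : linear (fun p : jet2 R => p.2). Proof. by []. Qed.
Lemma continuous_acc : continuous (fun p : jet2 R => p.2).
Proof. by move=> p; exact: cvg_snd. Qed.
Lemma linear_velacc1 : linear (fun p : velacc R => p.1). Proof. by []. Qed.
Lemma continuous_velacc1 : continuous (fun p : velacc R => p.1).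
Proof. by move=> p; exact: cvg_fst. Qed.
Lemma linear_velacc2 : linear (fun p : velacc R => p.2). Proof. by []. Qed.
Lemma continuous_velacc2 : continuous (fun p : velacc R => p.2).
Proof. by move=> p; exact: cvg_snd. Qed.

Lemma open_jet1_dom : open (jet1_dom eta).
Proof. exact: (open_vdom linear_vel continuous_vel). Qed.

Lemma open_jet2_dom : open (jet2_dom eta).
Proof. exact: (open_vdom linear_vel2 continuous_vel2). Qed.

Lemma open_velacc_dom : open (velacc_dom eta).
Proof. exact: (open_vdom linear_velacc1 continuous_velacc1). Qed.

End Coordinates.

(** * Linearization of the Lorentz fields *)

Section LorentzField.
Context {R : realType} (eta : 'I_2 -> R) (beta : 'cV[R]_2) (omega : R).

Definition lorentz_field_diff (p w : jet2 R) : jet2 R :=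
  let v := vel p.1 in let v' := p.2 in
  (- dot eta beta (pos w.1),
   time w.1 *: beta + omega *: rotation eta (pos w.1),
   dot eta beta (vel w.1) *: v + dot eta beta v *: vel w.1
     + omega *: rotation eta (vel w.1),
   (2 * dot eta beta (vel w.1)) *: v' + (2 * dot eta beta v) *: w.2
     + dot eta beta w.2 *: v + dot eta beta v' *: vel w.1
     + omega *: rotation eta w.2).

Lemma derive_lorentz_field p w :
  'D_w (lorentz_field eta beta omega) p = lorentz_field_diff p w.
Proof.
(* The second-order part in the increment, produced by the terms (beta.v) v, 2 (beta.v) v' and
   (beta.v') v of the field. *)
pose Q : jet2 R := (0, 0, dot eta beta (vel w.1) *: vel w.1,
  (2 * dot eta beta (vel w.1)) *: w.2 + dot eta beta w.2 *: vel w.1).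
apply: (@derive_quadratic _ _ _ _ _ _ _ Q) => h; rewrite /Q.
case: p w {Q} => [[[t x] v] v'] [[[t1 x1] v1] v1'].
rewrite /lorentz_field /lorentz_field_diff /time /pos /vel /=.
rewrite -[_ + (_, _, _, _)]/(_, _, _, _) /=.
by congr (_, _, _, _); try apply: colP2; rewrite ?mxE ?dotE ?mxE /GRing.scale/=; ring.
Qed.

End LorentzField.

(** * The invariant equation *)

Section VelocityFunctions.
Context {R : realType} (g : 'cV[R]_2 -> R).

Lemma px_vel i : px i (g \o @vel R) = cst 0.
Proof.
by apply/funext => p; apply: derive_const_along => h; rewrite /= /vel/= scaler0 add0r.
Qed.

Lemma D1_vel : D1 (g \o @vel R) = cst 0.
Proof.
apply/funext => p; rewrite /D1; under eq_bigr do rewrite px_vel mulr0.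
rewrite big1// addr0.
by apply: derive_const_along => h; rewrite /= /vel/= scaler0 add0r.
Qed.

Lemma pv_vel i : pv i (g \o @vel R) = (fun v => 'D_(delta_mx i 0) g v) \o @vel R.
Proof. by []. Qed.

End VelocityFunctions.

Section InvariantEquation.
Context {R : realType} (eta : 'I_2 -> R).
Hypothesis heta : forall i, eta i = 1 \/ eta i = -1.
Variable mu : R.
Local Notation sq v := (1 + dot eta v v).

Definition coefA_vel (v : 'cV[R]_2) : 'M[R]_2 :=
  (sq v `^ (- (3 / 2))) *: levi_civita.

(** The form N = s g - v_low v_low^T, of determinant eta_0 eta_1 s; N v' is the bracket multiplied
    by mu in the invariant equation. *)
Definition proj (v : 'cV[R]_2) : 'M[R]_2 :=
  \matrix_(i, j) (sq v * (eta i * (i == j)%:R) - eta i * v i 0 * (eta j * v j 0)).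

Definition coefB_vel (v : 'cV[R]_2) : 'M[R]_2 :=
  (- mu * (sq v `^ (- (3 / 2)))) *: proj v.

Definition coefA (p : jet1 R) := coefA_vel (vel p).
Definition coefB (p : jet1 R) := coefB_vel (vel p).
Definition coefc (p : jet1 R) : 'cV[R]_2 := 0.

Lemma entry_coefc i : entry coefc i 0 = (fun v : 'cV[R]_2 => 0) \o @vel R.
Proof. by apply/funext => p; rewrite /entry mxE. Qed.

Lemma levi_civitaE : (@levi_civita R 0 0 = 0) * (@levi_civita R 0 1 = 1) *
  (@levi_civita R 1 0 = -1) * (@levi_civita R 1 1 = 0).
Proof. by do !split; rewrite mxE /= ?subrr ?subr0 ?sub0r. Qed.

Lemma vdom_powR v (n : nat) (a : R) : vdom eta v ->
  sq v `^ (a + n%:R) = sq v ^+ n * sq v `^ a.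
Proof.
rewrite /vdom /= => v0; rewrite powRD; last by apply/implyP => _; rewrite gt_eqF.
by rewrite powR_mulrn ?ltW// mulrC.
Qed.

(** Together with [powR_m5] this reduces the powers of s met in the derivatives of A and k to the
    single atom s^(-7/2), so that the remaining identities are polynomial. *)
Lemma powR_m3 v : vdom eta v -> sq v `^ (- (3 / 2)) = sq v ^+ 2 * sq v `^ (- (7 / 2)).
Proof. by move=> v0; rewrite -vdom_powR//; congr powR; field. Qed.

Lemma powR_m5 v : vdom eta v -> sq v `^ (- (5 / 2)) = sq v * sq v `^ (- (7 / 2)).
Proof.
by move=> v0; have := vdom_powR 1 (- (7 / 2)) v0; rewrite expr1 => <-; congr powR; field.
Qed.

Let linv := @linear_vel R.
Let cv := @continuous_vel R.

Lemma has_derivative_coefA p w i j : jet1_dom eta p ->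
  has_derivative (entry coefA i j) p w
    (- 3 * sq (vel p) `^ (- (5 / 2)) * dot eta (vel p) (vel w) * levi_civita i j).
Proof.
move=> dp.
have := has_derivativeM (has_derivative_norm_powR linv cv w (- (3 / 2)) dp)
  (has_derivative_cst (levi_civita i j) p w).
have -> : - (3 / 2) - 1 = - (5 / 2) :> R by field.
have -> : entry coefA i j = fun q => sq (vel q) `^ (- (3 / 2)) * levi_civita i j.
  by apply/funext => q; rewrite /entry /coefA /coefA_vel mxE.
by congr has_derivative; field.
Qed.

(** The vector k in closed form: the first summand is (v'.d_v)A v', the second is B v'. *)
Definition coefk (i : 'I_2) (v v' : 'cV[R]_2) : R :=
  (- 3 * sq v `^ (- (5 / 2)) * dot eta v v') *
    (levi_civita i 0 * v' 0 0 + levi_civita i 1 * v' 1 0)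
  + (- mu * sq v `^ (- (3 / 2))) * (eta i * (sq v * v' i 0 + - (v i 0 * dot eta v v'))).

Lemma dot_delta v l : dot eta v (delta_mx l 0) = eta l * v l 0.
Proof. by case: (ord2P l) => ->; rewrite dotE !mxE/= ?(mulr0, mulr1, addr0, add0r). Qed.

Lemma kvec_coef p i : jet2_dom eta p ->
  kvec coefA coefB coefc p i 0 = coefk i (vel p.1) p.2.
Proof.
move=> dp; rewrite /kvec !mxE /dA_along !sum2E !mxE !sum2E.
have D l j := (has_derivative_coefA (e_v R l) i j dp).2.
rewrite /pv !D /= !dot_delta /coefB/coefB_vel/proj/coefk !mxE.
by case: (ord2P i) => -> /=; rewrite !dotE; ring.
Qed.

Lemma smooth_coefA i j : smooth (jet1_dom eta) (entry coefA i j).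
Proof.
have -> : entry coefA i j = fun q => sq (vel q) `^ (- (3 / 2)) * levi_civita i j.
  by apply/funext => q; rewrite /entry /coefA /coefA_vel mxE.
have oU := @open_jet1_dom R eta.
apply: smoothM => //; last exact: smooth_cst.
exact: smooth_norm_powR.
Qed.

Lemma smooth_coefB i j : smooth (jet1_dom eta) (entry coefB i j).
Proof.
have oU := @open_jet1_dom R eta.
have -> : entry coefB i j = fun q => (- mu * sq (vel q) `^ (- (3 / 2))) *
    (sq (vel q) * (eta i * (i == j)%:R) + - ((eta i * vel q i 0) * (eta j * vel q j 0))).
  by apply/funext => q; rewrite /entry /coefB /coefB_vel /proj !mxE.
do ![apply: smooth_norm_powR => //|apply: smooth_dot => //
    |apply: smooth_coord => //|apply: smoothN => //
    |apply: smoothD => //|apply: smoothM => //|exact: smooth_cst].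
Qed.

Lemma has_derivative_coefB p w i j : jet1_dom eta p ->
  has_derivative (entry coefB i j) p w (let v := vel p in
    - mu * sq v `^ (- (7 / 2)) *
    (- 3 * sq v * dot eta v (vel w) * proj v i j +
     sq v ^+ 2 * (2 * dot eta v (vel w) * (eta i * (i == j)%:R)
       - eta i * eta j * (vel w i 0 * v j 0 + v i 0 * vel w j 0)))).
Proof.
move=> dp /=.
have C c := has_derivative_cst c p w.
have X i := has_derivative_coord linv cv i p w.
have N := has_derivative_norm_powR linv cv w (- (3 / 2)) dp.
have D := has_derivativeD (C 1) (has_derivative_dot eta linv cv linv cv p w).
have := has_derivativeM (has_derivativeM (C (- mu)) N)
  (has_derivativeD (has_derivativeM D (C (eta i * (i == j)%:R)))
  (has_derivativeN (has_derivativeM (has_derivativeM (C (eta i)) (X i))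
     (has_derivativeM (C (eta j)) (X j))))).
have -> : - (3 / 2) - 1 = - (5 / 2) :> R by field.
have -> : entry coefB i j = fun q => (- mu * sq (vel q) `^ (- (3 / 2))) *
    (sq (vel q) * (eta i * (i == j)%:R) + - ((eta i * vel q i 0) * (eta j * vel q j 0))).
  by apply/funext => q; rewrite /entry /coefB /coefB_vel /proj !mxE.
congr has_derivative; rewrite powR_m5// powR_m3// /proj mxE.
by rewrite !dotE; field.
Qed.

(** The coefficients depend on v alone and c = 0, so every term with a derivative in x or a [D1]
    vanishes. There remain the alternation over three indices, zero in dimension 2, the symmetry of
    B, and the curl condition d_[i B_j]l = 0, which is computed. *)
Lemma variational_coef : variational eta coefA coefB coefc.
Proof.
have px0 g i p : px i (g \o @vel R) p = 0 by rewrite px_vel.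
have D10 g p : D1 (g \o @vel R) p = 0 by rewrite D1_vel.
have pxA i j l p : px l (entry coefA i j) p = 0 by exact: (px0 (fun v => coefA_vel v i j)).
have pxB i j l p : px l (entry coefB i j) p = 0 by exact: (px0 (fun v => coefB_vel v i j)).
have pxc j l p : px l (entry coefc j 0) p = 0 by rewrite entry_coefc px0.
have pvc i j : pv i (entry coefc j 0) = (fun=> 0) \o @vel R.
  by rewrite entry_coefc pv_vel; apply/funext => p; exact: derive_cst.
have altc i j : (fun q => alt2 (fun i j => pv i (entry coefc j 0) q) i j) = (fun=> 0) \o @vel R.
  by apply/funext => q; rewrite /alt2 !pvc/= subrr mul0r.
have D1A i j : D1 (entry coefA i j) = (fun=> 0) \o @vel R.
  exact: (D1_vel (fun v => coefA_vel v i j)).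
have D1pvA i j l : D1 (pv l (entry coefA i j)) = (fun=> 0) \o @vel R.
  exact: (D1_vel (fun v => 'D_(delta_mx l 0) (fun v => coefA_vel v i j) v)).
have pvB p l i j (dp : jet1_dom eta p) := (has_derivative_coefB (e_v R l) i j dp).2.
split=> p dp.
- move=> i j l; rewrite /alt3.
  have pvA k i j := (has_derivative_coefA (e_v R k) i j dp).2.
  rewrite /pv !pvA !dot_delta.
  by case: (ord2P i) => ->; case: (ord2P j) => ->; case: (ord2P l) => ->;
    rewrite !levi_civitaE; field.
- move=> i j; rewrite D1A /= mulr0 subr0 /alt2 /coefB /coefB_vel /proj !mxE eq_sym.
  by case: (ord2P i) => ->; case: (ord2P j) => ->; rewrite /=; field.
- move=> i j l; rewrite D1pvA /alt2 !pxA /pv !pvB// !dot_delta /proj !mxE /= !dotE.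
  by case: (heta 0) => e0; case: (heta 1) => e1; case: (ord2P i) => ->;
    case: (ord2P j) => ->; case: (ord2P l) => ->; rewrite /= ?e0 ?e1; field.
- move=> i j; rewrite /sym2 !pvc /=.
  have -> : D1 (fun q => (coefB q i j + coefB q j i) / 2) p = 0.
    exact: (D10 (fun v => (coefB_vel v i j + coefB_vel v j i) / 2)).
  by rewrite addr0 mul0r subr0.
- move=> i j l; rewrite altc D1pvA D10.
  have -> : (fun q => alt3 (fun i j l => px i (entry coefA j l) q) i j l) = (fun=> 0) \o @vel R.
    by apply/funext => q; rewrite /alt3 !pxA !(addr0, subr0) mul0r.
  have -> : pv l ((fun=> 0) \o @vel R) p = 0 by exact: derive_cst.
  by rewrite D10 /alt2 !pxB subrr mul0r !mulr0 subr0 !addr0.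
- move=> i j; have D1z : D1 ((fun=> 0 : R) \o @vel R) = (fun=> 0) \o @vel R by exact: D1_vel.
  by rewrite D1A altc !D1z /alt2 !pxc /= subrr mul0r !mulr0 !subr0.
Qed.

Lemma ep_form_coef p w i : jet2_dom eta p ->
  ep_form coefA coefB coefc p w i 0 = sq (vel p.1) `^ (- (3 / 2)) *
     (levi_civita i 0 * w.2 0 0 + levi_civita i 1 * w.2 1 0) +
     time w.1 * coefk i (vel p.1) p.2.
Proof.
move=> dp; rewrite /ep_form mxE [X in _ + X]mxE kvec_coef//; congr (_ + _).
by rewrite /coefA /coefA_vel mxE sum2E !mxE /=; ring.
Qed.

Lemma derive_ep_form (i : 'I_2) p u w : jet2_dom eta p ->
  'D_u (fun q => ep_form coefA coefB coefc q w i 0) p =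
  let v := vel p.1 in let v' := p.2 in
  let dv := vel u.1 in let dv' := u.2 in
  let d := dot eta v dv in let e := dot eta v v' in
  let de := dot eta dv v' + dot eta v dv' in
  sq v `^ (- (7 / 2)) *
  (- 3 * sq v * d * (levi_civita i 0 * w.2 0 0 + levi_civita i 1 * w.2 1 0)
  + time w.1 * (
    (15 * d * e - 3 * sq v * de) * (levi_civita i 0 * v' 0 0 + levi_civita i 1 * v' 1 0)
    - 3 * sq v * e * (levi_civita i 0 * dv' 0 0 + levi_civita i 1 * dv' 1 0)
    + 3 * mu * sq v * d * (eta i * (sq v * v' i 0 - v i 0 * e))
    - mu * sq v ^+ 2 * (eta i * (2 * d * v' i 0 + sq v * dv' i 0 - dv i 0 * e - v i 0 * de)))).
Proof.
move=> dp.
(* The closed form of k holds on the domain, which is open; it may therefore be substituted under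
   the derivative. *)
have -> : 'D_u (fun q => ep_form coefA coefB coefc q w i 0) p =
  'D_u (fun q => sq (vel q.1) `^ (- (3 / 2)) *
     (levi_civita i 0 * w.2 0 0 + levi_civita i 1 * w.2 1 0) +
     time w.1 * coefk i (vel q.1) q.2) p.
  apply: near_eq_derive; apply: filterS (open_nbhs_nbhs (conj (@open_jet2_dom R eta) dp)).
  by move=> q dq; exact: ep_form_coef.
have lv := @linear_vel2 R; have cv2 := @continuous_vel2 R.
have la := @linear_acc R; have ca := @continuous_acc R.
have C c := has_derivative_cst c p u.
have X i := has_derivative_coord lv cv2 i p u.
have Y i := has_derivative_coord la ca i p u.
have N3 := has_derivative_norm_powR lv cv2 u (- (3 / 2)) dp.
have N5 := has_derivative_norm_powR lv cv2 u (- (5 / 2)) dp.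
have D := has_derivativeD (C 1) (has_derivative_dot eta lv cv2 lv cv2 p u).
have V := has_derivative_dot eta lv cv2 la ca p u.
have [_ ->] := has_derivativeD
  (has_derivativeM N3 (C (levi_civita i 0 * w.2 0 0 + levi_civita i 1 * w.2 1 0)))
  (has_derivativeM (C (time w.1))
   (has_derivativeD
     (has_derivativeM (has_derivativeM (has_derivativeM (C (- 3)) N5) V)
       (has_derivativeD (has_derivativeM (C (levi_civita i 0)) (Y 0))
                        (has_derivativeM (C (levi_civita i 1)) (Y 1))))
     (has_derivativeM (has_derivativeM (C (- mu)) N3)
       (has_derivativeM (C (eta i)) (has_derivativeD (has_derivativeM D (Y i))
          (has_derivativeN (has_derivativeM (X i) V))))))).
have -> : - (3 / 2) - 1 = - (5 / 2) :> R by field.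
have -> : - (5 / 2) - 1 = - (7 / 2) :> R by field.
rewrite powR_m5// powR_m3//=.
have -> : dot eta (vel u.1) (vel p.1) = dot eta (vel p.1) (vel u.1) by rewrite !dotE; ring.
by field.
Qed.

Lemma lorentz_coef : lorentz_invariant eta coefA coefB coefc.
Proof.
move=> beta omega.
(* [Rot] is the matrix of [rotation]; its transpose enters [Phi] because the equation is a covector.
   The dv', dx and dv components of the invariance condition dictate [Phi], [Xi] and [Pi]
   respectively; the dt component then has to hold by itself. *)
pose Rot : 'M[R]_2 := \matrix_(i, j) ((j < i)%N%:R * eta 0 - (i < j)%N%:R * eta 1).
pose Phi (y : velacc R) : 'M[R]_2 :=
  \matrix_(i, j) (- (eta i * beta i 0) * y.1 j 0 + - (omega * Rot j i)).
pose Xi (y : velacc R) : 'M[R]_2 :=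
  \matrix_(i, j) (- (eta j * beta j 0) * coefk i y.1 y.2).
pose Pi (y : velacc R) : 'M[R]_2 :=
  \matrix_(i, j) (sq y.1 `^ (- (3 / 2)) *
    (2 * (eta j * beta j 0) * (levi_civita i 0 * y.2 0 0 + levi_civita i 1 * y.2 1 0)
    + levi_civita i j * dot eta beta y.2)).
have oU := @open_velacc_dom R eta.
have l1 := @linear_velacc1 R; have c1 := @continuous_velacc1 R.
have l2 := @linear_velacc2 R; have c2 := @continuous_velacc2 R.
exists Phi, Xi, Pi; split.
- move=> i j; under eq_fun do rewrite mxE.
  do ![apply: smooth_coord => //|apply: smoothD => //|apply: smoothM => //|exact: smooth_cst].
- move=> i j; under eq_fun do rewrite mxE /coefk.
  do ![exact: (smooth_coord l1 c1)|exact: (smooth_coord l2 c2)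
      |apply: smooth_norm_powR => //|exact: (smooth_dot _ l1 c1 l1 c1)
      |exact: (smooth_dot _ l1 c1 l2 c2)
      |apply: smoothN => //|apply: smoothD => //|apply: smoothM => //|exact: smooth_cst].
- move=> i j; under eq_fun do rewrite mxE.
  under eq_fun do rewrite [dot eta beta _]dotE.
  do ![exact: (smooth_coord l2 c2)|apply: smooth_norm_powR => //
      |apply: smoothD => //|apply: smoothM => //|exact: smooth_cst].
move=> p dp w i y.
rewrite /lie_derivative derive_ep_form// derive_lorentz_field.
rewrite [RHS]mxE [X in _ = X + _]mxE.
have mulmxE (M : 'M[R]_2) (u : 'cV[R]_2) : (M *m u) i 0 = M i 0 * u 0 0 + M i 1 * u 1 0.
  by rewrite mxE sum2E.
rewrite !mulmxE !ep_form_coef// ![Phi _ _ _]mxE ![Xi _ _ _]mxE ![Pi _ _ _]mxE ![Rot _ _]mxE.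
case: p w dp @y => [[[t x] v] v'] [[[t1 x1] v1] v1'] /= dp.
rewrite /lorentz_field /lorentz_field_diff /time /pos /vel /=.
rewrite /coefk powR_m3// powR_m5//.
(* With the power of s made an atom, each component is a polynomial identity that uses eta_i = 1 or
   -1. *)
move: (sq v `^ (- (7 / 2))) => r.
case: (ord2P i) => ->; rewrite ?dotE !mxE /= ?dotE ?mxE /=.
all: case: (heta 0) => ->; case: (heta 1) => ->; ring.
Qed.

Lemma vdom0 : vdom eta 0.
Proof. by rewrite /vdom /= dotE !mxE !(mulr0, addr0). Qed.

Lemma euler_poisson_coef : euler_poisson eta coefA coefB coefc.
Proof.
split.
- exact: smooth_coefA.
- exact: smooth_coefB.
- by move=> i; rewrite entry_coefc; exact: smooth_cst.
- move=> p dp; apply/matrixP => i j; rewrite /coefA /coefA_vel !mxE.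
  by ring.
- move=> p dp; apply/matrixP => i j; rewrite /coefB /coefB_vel /proj !mxE eq_sym.
  by case: eqVneq => [->//|_] /=; rewrite !mulr0 [X in _ - X]mulrC.
- exists 0; split; first exact: vdom0.
  move=> /matrixP/(_ 0 1); rewrite /coefA /coefA_vel !mxE /= dotE !mxE.
  rewrite !(mulr0, addr0) powR1 subr0 mulr1 => /eqP.
  by rewrite oner_eq0.
- exact: variational_coef.
Qed.

Lemma poincare_invariant_coef : poincare_invariant eta coefA coefB coefc.
Proof.
split; last exact: lorentz_coef.
split=> t1 t2 x1 x2 v; first by [].
move=> v' dv; have dp t x : jet2_dom eta (t, x, v, v') by [].
have H i := etrans (kvec_coef i (dp t1 x1)) (esym (kvec_coef i (dp t2 x2))).
by apply: colP2; exact: H.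
Qed.

(** [star] contracts the first index of [levi_civita], so J w = - [star] w; this accounts for the
    signs of the first two terms. *)
Lemma ep_lhs_coef p v'' : jet2_dom eta p ->
  ep_lhs coefA coefB coefc p v'' = invariant_lhs eta mu (vel p.1) p.2 v''.
Proof.
move=> dp; rewrite /ep_lhs -!addrA [X in _ + X]addrA -/(kvec coefA coefB coefc p).
have H i : (coefA p.1 *m v'' + kvec coefA coefB coefc p) i 0 =
  invariant_lhs eta mu (vel p.1) p.2 v'' i 0.
  rewrite mxE kvec_coef// /coefk /invariant_lhs !mxE !sum2E !mxE -!powRN.
  case: (ord2P i) => ->; rewrite /= !dotE; ring.
by apply: colP2; exact: H.
Qed.

End InvariantEquation.

(** * Uniqueness *)

Section StarShaped.
Context {R : realType} (eta : 'I_2 -> R).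

(** With d = v.v, the number 1 + r^2 d lies between 1 and 1 + d. The sign of d matters because the
    metric may be indefinite. *)
Lemma vdom_scale (r : R) v : 0 <= r <= 1 -> vdom eta v -> vdom eta (r *: v).
Proof.
move=> /andP[r0 r1]; rewrite /vdom /= !dotE !mxE => v0.
set d := eta 0 * v 0 0 * v 0 0 + eta 1 * v 1 0 * v 1 0 in v0 *.
have -> : eta 0 * (r * v 0 0) * (r * v 0 0) + eta 1 * (r * v 1 0) * (r * v 1 0)
  = r ^+ 2 * d by rewrite /d; ring.
have r2 : 0 <= r ^+ 2 <= 1 by rewrite exprn_ge0//= exprn_ile1.
case: (lerP 0 d) => d0; nra.
Qed.

(** The domain is star-shaped about 0, so the mean value theorem applies to F along the segment from
    0 to v. *)
Lemma const_on_vdom (F : jet1 R -> R) :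
  (forall v, vdom eta v -> differentiable F (0, 0, v)) ->
  (forall v i, vdom eta v -> pv i F (0, 0, v) = 0) ->
  forall v, vdom eta v -> F (0, 0, v) = F (0, 0, 0).
Proof.
move=> dF F0 v dv; pose f (r : R) := F (0, 0, r *: v).
have D u w : vdom eta u -> 'D_((0, 0, w) : jet1 R) F (0, 0, u) = 0.
  move=> du; rewrite deriveE; last exact: dF.
  have -> : (0, 0, w) = w 0 0 *: e_v R 0 + w 1 0 *: e_v R 1 :> jet1 R.
    rewrite /e_v -[RHS]/(_, _, _); congr (_, _, _); rewrite /= ?scaler0 ?addr0//.
    by apply: colP2; rewrite !mxE/= !(mulr1, mulr0, addr0, add0r).
  rewrite linearD !linearZ -!deriveE; try exact: dF.
  have /= := F0 u 0 du; rewrite /pv => ->; have /= := F0 u 1 du; rewrite /pv => ->.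
  by rewrite !scaler0 addr0.
have fd (r : R) : 0 <= r <= 1 -> is_derive r 1 f 0.
  move=> r01; have dr := vdom_scale r01 dv.
  have e : (fun h : R => h^-1 *: ((f \o shift r) (h *: 1) - f r)) =
    (fun h : R => h^-1 *: ((F \o shift (0, 0, r *: v)) (h *: (0, 0, v)) - F (0, 0, r *: v))).
    apply/funext => h /=; congr (_ *: (F _ - _)).
    rewrite /shift /= -[RHS]/(_, _, _) /= !scaler0 !addr0; congr (_, _, _).
    by rewrite -scalerDl [h%:A]mulr1.
  split.
    have : derivable F (0, 0, r *: v) ((0, 0, v) : jet1 R).
      by apply: diff_derivable; exact: dF.
    by rewrite /derivable -e.
  by have := D _ v dr; rewrite /derive -e.
have [||r _] := @MVT R f (fun=> 0) 0 1 ltr01.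
- by move=> r; rewrite in_itv/= => /andP[r0 r1]; apply: fd; rewrite !ltW.
- apply: derivable_within_continuous => r; rewrite in_itv/= => r01.
  by have [] := fd r r01.
by rewrite mul0r => /eqP; rewrite subr_eq0 /f scale1r scale0r => /eqP.
Qed.

End StarShaped.

(** * Functions independent of time and position *)

Section TranslationInvariance.
Context {R : realType} (eta : 'I_2 -> R).

(** Agreement is asked over the domain only, since the values of the coefficients elsewhere are
    arbitrary. *)
Definition tx_const (f : jet1 R -> R) := forall t1 t2 x1 x2 v,
  vdom eta v -> f (t1, x1, v) = f (t2, x2, v).

Lemma px_tx_const f i p : tx_const f -> jet1_dom eta p -> px i f p = 0.
Proof.
move=> cf; case: p => [[t x] v] dp; apply: derive_const_along => h.
rewrite -[h *: _ + _]/(_, _, _) /= !scaler0 !add0r; exact: cf.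
Qed.

Lemma D1_tx_const f p : tx_const f -> jet1_dom eta p -> D1 f p = 0.
Proof.
move=> cf dp; rewrite /D1 sum2E !px_tx_const// !mulr0 !addr0.
case: p dp => [[t x] v] dp; apply: derive_const_along => h.
rewrite -[h *: _ + _]/(_, _, _) /= !scaler0 !add0r; exact: cf.
Qed.

(** A velocity derivative is taken inside one slice of fixed (t, x). Precomposition carries it from
    one slice to the other, where the two functions agree near the point. *)
Lemma pv_tx_const f l : tx_const f -> tx_const (pv l f).
Proof.
move=> cf t1 t2 x1 x2 v dv.
have -> : pv l f (t1, x1, v) = 'D_(e_v R l) (f \o (fun q => (t1, x1, vel q))) (t2, x2, v).
  apply: eq_derive_line => h.
  by rewrite /= -[h *: _ + _]/(_, _, _) /vel /= !scaler0 !add0r.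
apply: near_eq_derive.
apply: filterS (open_nbhs_nbhs (conj (@open_jet1_dom R eta) (dv : jet1_dom eta (t2, x2, v)))).
by move=> [[t x] u] du; exact: cf du.
Qed.

End TranslationInvariance.

(** The linear algebra behind uniqueness, with (p, q) = v' and d0, d1 the gradient of a. The
    quantity t is eta_0 eta_1 tr(adj(N) B); it equals 2 s f when B = f N, because det N = eta_0
    eta_1 s, so it yields the factor of proportionality without a division. *)
Lemma stabilizer_algebra (R : realFieldType) (e0 e1 x y a d0 d1 b00 b01 b11 c0 c1 : R) :
  (e0 = 1 \/ e0 = -1) -> (e1 = 1 \/ e1 = -1) ->
  let s := 1 + (e0 * x * x + e1 * y * y) in s != 0 ->
  (forall p q : R,
    let V := d0 * p + d1 * q in
    let k0 := V * q + b00 * p + b01 * q + c0 in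
    let k1 := - V * p + b01 * p + b11 * q + c1 in
    let b := e0 * e1 * (y * p - x * q) in
    let m0 := b * x - e1 * q in
    let m1 := b * y + e0 * p in
    let bk := e0 * e1 * (y * k1 + x * k0) in
    let D := d0 * m0 + d1 * m1 in
    D * q + V * m1 + b00 * m0 + b01 * m1 + 3 * b * a * q + bk * y + e0 * k1 = 0 /\
    - D * p - V * m0 + b01 * m0 + b11 * m1 - 3 * b * a * p - bk * x - e1 * k0 = 0) ->
  [/\ s * d0 = - 3 * a * (e0 * x), s * d1 = - 3 * a * (e1 * y), c0 = 0, c1 = 0 &
    let t := e0 * e1 * (b00 * (s * e1 - y * y) + 2 * b01 * (e0 * e1 * x * y)
               + b11 * (s * e0 - x * x)) in
    [/\ 2 * s * b00 = t * (s * e0 - x * x), 2 * s * b01 = - t * (e0 * e1 * x * y)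
      & 2 * s * b11 = t * (s * e1 - y * y)]].
Proof.
move=> he0 he1 s s0 H.
have [A0 A1] := H 0 0.
have [P0 P1] := H 1 0; have [N0 N1] := H (-1) 0.
have [Q0 Q1] := H 0 1; have [M0 M1] := H 0 (-1); move: {H} A0 A1 P0 P1 N0 N1 Q0 Q1 M0 M1.
rewrite /= !(mulr0, mul0r, mulr1, mul1r, add0r, addr0, subr0, sub0r, oppr0).
(* The field acts on v' by the traceless matrix M with rows (M00, M01) and (M10, - M00). The
   expression in [det] below is - det M. *)
pose M00 := e0 * e1 * x * y; pose M01 := - e1 - e0 * e1 * x * x.
pose M10 := e0 + e0 * e1 * y * y.
move=> A0 A1 P0 P1 N0 N1 Q0 Q1 W0 W1.
have ee0 : e0 * e0 = 1 by case: he0 => ->; ring.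
have ee1 : e1 * e1 = 1 by case: he1 => ->; ring.
(* The values at v' = 0, +-e_1, +-e_2 separate the homogeneous parts. *)
have D0 : d0 * M00 + d1 * M10 = - 3 * a * (e0 * e1 * y) by rewrite /M00 /M10; lra.
have D1 : d0 * M01 - d1 * M00 = 3 * a * (e0 * e1 * x) by rewrite /M00 /M01; lra.
have C0 : M00 * c1 - M01 * c0 = 0 by rewrite /M00 /M01; lra.
have C1 : M10 * c1 + M00 * c0 = 0 by rewrite /M00 /M10; lra.
have B0 : b00 * M00 + b01 * M10 = 0 by rewrite /M00 /M10; lra.
have B1 : b01 * M01 - b11 * M00 = 0 by rewrite /M00 /M01; lra.
have B2 : b00 * M01 + b11 * M10 = 0 by rewrite /M01 /M10; lra.
clear A0 A1 P0 P1 N0 N1 Q0 Q1 W0 W1.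
have det : M00 * M00 + M01 * M10 = - e0 * e1 * s.
  by rewrite /M00 /M01 /M10 /s; case: he0 => ->; case: he1 => ->; ring.
have e0n : e0 != 0 by case: he0 => ->; rewrite ?oppr_eq0 oner_eq0.
have e1n : e1 != 0 by case: he1 => ->; rewrite ?oppr_eq0 oner_eq0.
have detn : - e0 * e1 * s != 0 by rewrite !mulf_neq0 ?oppr_eq0.
have N0E : s * e0 - x * x = M10 by rewrite /s /M10; case: he0 => ->; ring.
have N1E : s * e1 - y * y = - M01 by rewrite /s /M01; case: he1 => ->; ring.
rewrite N0E N1E -/M00.
(* Cramer's rule for the systems D0, D1 and C0, C1, whose determinants are det M up to sign. *)
split.
- apply: (mulfI (mulf_neq0 e0n e1n)).
  transitivity (- ((d0 * M00 + d1 * M10) * M00 + (d0 * M01 - d1 * M00) * M10)).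
    by transitivity (- (- e0 * e1 * s) * d0); [ring | rewrite -det; ring].
  by rewrite D0 D1 /M00 /M10; ring.
- apply: (mulfI (mulf_neq0 e0n e1n)).
  transitivity (- ((d0 * M00 + d1 * M10) * M01 - (d0 * M01 - d1 * M00) * M00)).
    by transitivity (- (- e0 * e1 * s) * d1); [ring | rewrite -det; ring].
  by rewrite D0 D1 /M00 /M01; ring.
- apply: (mulfI detn); rewrite -det mulr0.
  by transitivity (M00 * (M10 * c1 + M00 * c0) - M10 * (M00 * c1 - M01 * c0));
    [ring | rewrite C0 C1; ring].
- apply: (mulfI detn); rewrite -det mulr0.
  by transitivity (M00 * (M00 * c1 - M01 * c0) + M01 * (M10 * c1 + M00 * c0));
    [ring | rewrite C0 C1; ring].
have eE : (e0 * e1) * (- e0 * e1 * s) = - s.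
  by case: he0 => ->; case: he1 => ->; ring.
(* B0, B1 and B2 are the vanishing minors expressing that (b00, b01, b11) is parallel to (M10, -
   M00, - M01), the entries of N. *)
rewrite /= -[s]opprK -eE -det; split.
- transitivity (e0 * e1 * ((b00 * - M01 + 2 * b01 * M00 + b11 * M10) * M10
    - (b00 * M01 + b11 * M10) * M10 - 2 * M00 * (b00 * M00 + b01 * M10))); first by ring.
  by rewrite B0 B2; ring.
- transitivity (e0 * e1 * (- (b00 * - M01 + 2 * b01 * M00 + b11 * M10) * M00
    + (b00 * M01 + b11 * M10) * M00 - 2 * M01 * (b00 * M00 + b01 * M10))); first by ring.
  by rewrite B0 B2; ring.
- transitivity (e0 * e1 * ((b00 * - M01 + 2 * b01 * M00 + b11 * M10) * - M01
    - (b00 * M01 + b11 * M10) * M01 + 2 * M00 * (b01 * M01 - b11 * M00))); first by ring.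
  by rewrite B1 B2; ring.
Qed.

Section Uniqueness.
Context {R : realType} (eta : 'I_2 -> R).
Hypothesis heta : forall i, eta i = 1 \/ eta i = -1.
Variables (A B : jet1 R -> 'M[R]_2) (c : jet1 R -> 'cV[R]_2).
Hypothesis EP : euler_poisson eta A B c.
Hypothesis PI : poincare_invariant eta A B c.
Local Notation sq v := (1 + dot eta v v).

Lemma jet1_dom_near (p : jet1 R) : jet1_dom eta p -> \near p, jet1_dom eta p.
Proof. by move=> dp; apply: open_nbhs_nbhs; split; [exact: open_jet1_dom|]. Qed.

Lemma skewE p i j : jet1_dom eta p -> A p j i = - A p i j.
Proof. by move=> /(ep_skewA EP)/matrixP/(_ i j); rewrite !mxE. Qed.

Lemma symE p i j : jet1_dom eta p -> B p j i = B p i j.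
Proof. by move=> /(ep_symB EP)/matrixP/(_ i j); rewrite !mxE. Qed.

Lemma skew_diag p i : jet1_dom eta p -> A p i i = 0.
Proof. by move=> /(skewE i i) h; lra. Qed.

Lemma pv_skewE p l i j : jet1_dom eta p ->
  pv l (entry A j i) p = - pv l (entry A i j) p.
Proof.
move=> dp.
have Dij : derivable (entry A i j) p (e_v R l).
  exact/diff_derivable/(smooth_differentiable (ep_smoothA EP i j) dp).
rewrite /pv -deriveN//; apply: near_eq_derive.
by apply: filterS (jet1_dom_near dp) => q; exact: skewE.
Qed.

Lemma pv_skew_diag p l i : jet1_dom eta p -> pv l (entry A i i) p = 0.
Proof. by move=> /(pv_skewE l i i) h; lra. Qed.

Local Notation d l p := (pv l (entry A 0 1) p).

(** In dimension 2, A = a J with a = [A 0 1], so (v'.d_v)A v' = (grad a . v') J v'. *)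
Lemma kvecE0 p : jet2_dom eta p -> kvec A B c p 0 0 =
  (d 0 p.1 * p.2 0 0 + d 1 p.1 * p.2 1 0) * p.2 1 0 +
  B p.1 0 0 * p.2 0 0 + B p.1 0 1 * p.2 1 0 + c p.1 0 0.
Proof.
move=> dp; have dq : jet1_dom eta p.1 := dp.
rewrite /kvec !mxE !sum2E !mxE !sum2E !pv_skew_diag//.
move: (d 0 p.1) (d 1 p.1) (p.2 0 0) (p.2 1 0) (B p.1 0 0) (B p.1 0 1) => d0 d1 x y b0 b1.
by ring.
Qed.

Lemma kvecE1 p : jet2_dom eta p -> kvec A B c p 1 0 =
  - (d 0 p.1 * p.2 0 0 + d 1 p.1 * p.2 1 0) * p.2 0 0 +
  B p.1 0 1 * p.2 0 0 + B p.1 1 1 * p.2 1 0 + c p.1 1 0.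
Proof.
move=> dp; have dq : jet1_dom eta p.1 := dp.
rewrite /kvec !mxE !sum2E !mxE !sum2E !pv_skew_diag//.
rewrite !(pv_skewE _ 0 1)// (symE 0 1)//.
move: (d 0 p.1) (d 1 p.1) (p.2 0 0) (p.2 1 0) (B p.1 1 1) (B p.1 0 1) => d0 d1 x y b0 b1.
by ring.
Qed.

Lemma txA i j : tx_const eta (entry A i j).
Proof. by move=> t1 t2 x1 x2 v dv; rewrite /entry (PI.1.1 t1 t2 x1 x2). Qed.

Lemma kvec_acc0 p : kvec A B c (p, 0) = c p.
Proof. by rewrite /kvec !mulmx0 !add0r. Qed.

Lemma tx_c t1 t2 x1 x2 v : vdom eta v -> c (t1, x1, v) = c (t2, x2, v).
Proof. by move=> dv; rewrite -!kvec_acc0; exact: PI.1.2. Qed.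

(** Translation invariance concerns A and k. At v' = 0 the vector k is c; at v' = e_j, once c and
    the part quadratic in v' are cancelled, column j of B is left. *)
Lemma txB i j : tx_const eta (entry B i j).
Proof.
move=> t1 t2 x1 x2 v dv; rewrite /entry.
have := congr1 (fun k : 'cV[R]_2 => k i 0) (PI.1.2 t1 t2 x1 x2 v (delta_mx j 0) dv).
rewrite /kvec (tx_c t1 t2 x1 x2 dv) /=.
have -> : dA_along A (t1, x1, v, delta_mx j 0) *m delta_mx j 0 =
          dA_along A (t2, x2, v, delta_mx j 0) *m delta_mx j 0 :> 'cV[R]_2.
  by apply/colP => k; rewrite -!colE !mxE; apply: eq_bigr => l _;
    rewrite (pv_tx_const l (txA k j) t1 t2 x1 x2 dv).
by rewrite -!colE => /=; rewrite ![(_ + _ : 'cV_2) i 0]mxE ![col _ _ _ _]mxE => /addIr/addrI.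
Qed.

(** Since k has degree at most two in v', the central difference with unit step is exactly its
    directional derivative. *)
Lemma derive_ep_form_acc v v' m w i : vdom eta v ->
  let K i v' := kvec A B c (0, 0, v, v') i 0 in
  'D_(0, 0, 0, m) (fun q : jet2 R => ep_form A B c q w i 0) (0, 0, v, v') =
  time w.1 * ((K i (v' + m) - K i (v' - m)) / 2).
Proof.
move=> dv K.
have [a1 [a2 [a3 [a4 [a5 [a6 KE]]]]]] : exists a1 a2 a3 a4 a5 a6, forall u : 'cV[R]_2,
    K i u = a1 * u 0 0 * u 0 0 + a2 * u 0 0 * u 1 0 + a3 * u 1 0 * u 1 0 +
      a4 * u 0 0 + a5 * u 1 0 + a6.
  rewrite /K; case: (ord2P i) => ->.
    exists 0, (d 0 (0, 0, v)), (d 1 (0, 0, v)), (B (0, 0, v) 0 0),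
      (B (0, 0, v) 0 1), (c (0, 0, v) 0 0) => u.
    rewrite kvecE0//=.
    move: (d 0 (0, 0, v)) (d 1 (0, 0, v)) (u 0 0) (u 1 0)
      (B (0, 0, v) 0 0) (B (0, 0, v) 0 1) => d0 d1 x y b0 b1.
    by ring.
  exists (- d 0 (0, 0, v)), (- d 1 (0, 0, v)), 0, (B (0, 0, v) 0 1),
    (B (0, 0, v) 1 1), (c (0, 0, v) 1 0) => u.
  rewrite kvecE1//=.
  move: (d 0 (0, 0, v)) (d 1 (0, 0, v)) (u 0 0) (u 1 0)
    (B (0, 0, v) 1 1) (B (0, 0, v) 0 1) => d0 d1 x y b0 b1.
  by ring.
(* The second-order coefficient is the homogeneous quadratic part of [K] at [m], extracted from its
   values at m, -m and 0. *)
apply: (@derive_quadratic _ _ _ _ _ _ _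
  (time w.1 * ((K i m + K i (- m)) / 2 - K i 0))) => h.
rewrite -[h *: _ + _]/(_, _, _, _) /= !scaler0 !add0r.
have eE u : ep_form A B c (0, 0, v, u) w i 0 = (A (0, 0, v) *m w.2) i 0 + time w.1 * K i u.
  by rewrite /ep_form mxE [X in _ + X]mxE.
rewrite !eE !KE !mxE /GRing.scale/=.
move: ((A (0, 0, v) *m w.2) i 0) (m 0 0) (m 1 0) (v' 0 0) (v' 1 0) (time w.1) => q m0 m1 x y t.
by field.
Qed.

(** * The invariance condition over a fixed velocity *)

Section Stabilizer.
Variable v : 'cV[R]_2.
Hypothesis dv : vdom eta v.
Local Notation o := ((0, 0, v) : jet1 R).
Local Notation x := (v 0 0).
Local Notation y := (v 1 0).
Local Notation e0 := (eta 0).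
Local Notation e1 := (eta 1).

(* The tangent vector (1, v, v', w4) annihilates dx - v dt and dv - v' dt, and
   w4 is chosen so that A w4 + k = 0: no multiplier survives in the invariance
   condition. Here b = beta.v', (m0, m1) = M v' and bk = a (beta.w4). *)
Lemma stabilizer_eq v' : A o 0 1 != 0 ->
  let k0 := kvec A B c (0, 0, v, v') 0 0 in
  let k1 := kvec A B c (0, 0, v, v') 1 0 in
  let b := e0 * e1 * (y * v' 0 0 - x * v' 1 0) in
  let m0 := b * x - e1 * v' 1 0 in
  let m1 := b * y + e0 * v' 0 0 in
  let bk := e0 * e1 * (y * k1 + x * k0) in
  let D := d 0 o * m0 + d 1 o * m1 in
  let V := d 0 o * v' 0 0 + d 1 o * v' 1 0 in
  D * v' 1 0 + V * m1 + B o 0 0 * m0 + B o 0 1 * m1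
    + 3 * b * A o 0 1 * v' 1 0 + bk * y + e0 * k1 = 0 /\
  - D * v' 0 0 - V * m0 + B o 0 1 * m0 + B o 1 1 * m1
    - 3 * b * A o 0 1 * v' 0 0 - bk * x - e1 * k0 = 0.
Proof.
move=> a0 k0 k1 b m0 m1 bk D V.
(* With omega = 1 this cancels [rotation eta v], and beta.v = 0. As t = 0 and x = 0 at the chosen
   point, the field there has only its v' component [m]. *)
pose beta := - rotation eta v.
pose w4 : 'cV[R]_2 := \col_i (if i == 0 then k1 / A o 0 1 else - k0 / A o 0 1).
pose m : 'cV[R]_2 := \col_i (if i == 0 then m0 else m1).
pose w : jet2 R := (1, v, v', w4).
have [Phi [Xi [Pi [_ _ _ H]]]] := PI.2 beta 1.
have dp : jet2_dom eta (0, 0, v, v') by [].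
have {}H i := H (0, 0, v, v') dp w i.
have Xp : lorentz_field eta beta 1 (0, 0, v, v') = (0, 0, 0, m).
  rewrite /lorentz_field /time/pos/vel/=; congr (_, _, _, _).
  - by rewrite dotE !mxE !mulr0 addr0 oppr0.
  - by rewrite scale0r add0r; apply: colP2; rewrite !mxE/= ?mxE !(mulr0, oppr0).
  - by apply: colP2; rewrite !(dotE, mxE) /= ?mxE; ring.
  - by apply: colP2; rewrite !(dotE, mxE) /= ?mxE /m0 /m1 /b; ring.
have mulAE (u : 'cV[R]_2) : ((A o *m u) 0 0 = A o 0 1 * u 1 0) *
    ((A o *m u) 1 0 = - A o 0 1 * u 0 0).
  by split; rewrite mxE sum2E skew_diag// ?(skewE 0 1)//; rewrite mul0r ?add0r ?addr0.
have eE (u : jet2 R) i : ep_form A B c (0, 0, v, v') u i 0 =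
    (A o *m u.2) i 0 + time u.1 * kvec A B c (0, 0, v, v') i 0.
  by rewrite /ep_form mxE [X in _ + X]mxE.
have onshell : ep_form A B c (0, 0, v, v') w = 0.
  apply: colP2; rewrite eE mulAE -?/k0 -?/k1 /w /w4 [RHS]mxE mxE /time /=.
    by rewrite mul1r mulrCA mulfV// mulr1 addNr.
  by rewrite mul1r mulNr mulrCA mulfV// mulr1 addNr.
have {}H i : 'D_(0, 0, 0, m) (fun q : jet2 R => ep_form A B c q w i 0) (0, 0, v, v') +
    ep_form A B c (0, 0, v, v') (lorentz_field_diff eta beta 1 (0, 0, v, v') w) i 0 = 0.
  have := H i; rewrite /lie_derivative Xp derive_lorentz_field => ->.
  by rewrite onshell /time /pos /vel /= !scale1r !subrr !mulmx0 !addr0 mxE.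
have bE (u : 'cV[R]_2) : dot eta beta u = e0 * e1 * (y * u 0 0 - x * u 1 0).
  by rewrite dotE !mxE /= ?mxE; ring.
have {H} [H0 H1] := (H 0, H 1).
rewrite !derive_ep_form_acc// !eE !mulAE in H0 H1.
rewrite !kvecE0// !kvecE1// -/k0 -/k1 in H0 H1.
rewrite /lorentz_field_diff /time /pos /vel /= !bE !mxE /= in H0 H1.
move: H0 H1 a0; rewrite {onshell mulAE eE}/D /V /bk /b; clearbody w4.
clear Xp w; clearbody m0 m1 k0 k1.
move: (A o 0 1) (d 0 o) (d 1 o) (B o 0 0) (B o 0 1) (B o 1 1) (c o 0 0) (c o 1 0).
move: x y (v' 0 0) (v' 1 0) e0 e1 => ? ? ? ? ? ? ? ? ? ? ? ? ? ? H0 H1 a0.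
by split; [rewrite -[RHS]H0 | rewrite -[RHS]H1]; field.
Qed.

Lemma stabilizer_coef : A o 0 1 != 0 ->
  [/\ sq v * d 0 o = - 3 * A o 0 1 * (e0 * x), sq v * d 1 o = - 3 * A o 0 1 * (e1 * y),
    c o 0 0 = 0, c o 1 0 = 0 &
    let t := e0 * e1 * (B o 0 0 * proj eta v 1 1 - 2 * B o 0 1 * proj eta v 0 1
               + B o 1 1 * proj eta v 0 0) in
    forall i j, 2 * sq v * B o i j = t * proj eta v i j].
Proof.
move=> a0.
have s0 : 1 + (e0 * x * x + e1 * y * y) != 0.
  by have := dv; rewrite /vdom /= dotE => /gt_eqF->.
have H p q := stabilizer_eq (\col_i (if i == 0 then p else q)) a0.
have [|d0 d1 c0 c1 Bij] := @stabilizer_algebra R e0 e1 x y (A o 0 1) (d 0 o) (d 1 o)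
  (B o 0 0) (B o 0 1) (B o 1 1) (c o 0 0) (c o 1 0) (heta 0) (heta 1) s0.
  move=> p q; have := H p q; rewrite kvecE0// kvecE1//= !mxE /=; exact.
rewrite dotE; split=> // t i j.
have ee i' : eta i' * eta i' = 1 by case: (heta i') => ->; ring.
have P00 : proj eta v 0 0 = (1 + (e0 * x * x + e1 * y * y)) * e0 - x * x.
  by rewrite /proj mxE /= dotE mulr1 mulrACA ee mul1r.
have P11 : proj eta v 1 1 = (1 + (e0 * x * x + e1 * y * y)) * e1 - y * y.
  by rewrite /proj mxE /= dotE mulr1 mulrACA ee mul1r.
have P01 : proj eta v 0 1 = - (e0 * e1 * x * y) by rewrite /proj mxE /=; ring.
have P10 : proj eta v 1 0 = - (e0 * e1 * x * y) by rewrite /proj mxE /=; ring.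
have tE : t = e0 * e1 * (B o 0 0 * ((1 + (e0 * x * x + e1 * y * y)) * e1 - y * y)
    + 2 * B o 0 1 * (e0 * e1 * x * y)
    + B o 1 1 * ((1 + (e0 * x * x + e1 * y * y)) * e0 - x * x)).
  by rewrite /t P00 P11 P01 mulrN opprK.
move: Bij; rewrite /= -tE => -[B00 B01 B11].
case: (ord2P i) => ->; case: (ord2P j) => ->; rewrite ?P00 ?P01 ?P10 ?P11 //.
- by rewrite B01 mulrN mulNr.
- by rewrite (symE 0 1)// B01 mulrN mulNr.
Qed.

(** Here one cannot divide by a. The test vector is instead purely along v': its dt, dx and dv
    components vanish, which removes [Xi] and [Pi], and A = 0 removes [Phi]. *)
Lemma derive_at_zero l : A o 0 1 = 0 -> d l o = 0.
Proof.
move=> a0; have s0 : sq v != 0 by rewrite gt_eqF.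
have Ao : A o = 0.
  apply/matrixP => i j; rewrite mxE; case: (ord2P i) => ->; case: (ord2P j) => ->;
    by rewrite ?skew_diag// ?(skewE 0 1)// a0 ?oppr0.
pose u : 'cV[R]_2 := delta_mx l 0.
(* This solves beta + (beta.v) v = u: indeed beta.v = k. At v' = 0 the field with omega = 0 is then
   exactly the direction e_l in velocity space. *)
pose k := dot eta u v / sq v; pose beta := u - k *: v.
have bv : dot eta beta v = k.
  have -> : dot eta beta v = dot eta u v - k * dot eta v v by rewrite /beta !dotE !mxE; ring.
  by rewrite /k; move: (dot eta u v) (dot eta v v) s0 => a b s0; field.
(* Component 0 of the form on this vector is the entry [A 0 1]. *)
pose w : jet2 R := (0, 0, 0, delta_mx 1 0).
have [Phi [Xi [Pi [_ _ _ H]]]] := PI.2 beta 0.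
have dp : jet2_dom eta (0, 0, v, 0) by [].
have := H (0, 0, v, 0) dp w 0.
have eE (w' : jet2 R) : time w'.1 = 0 -> ep_form A B c (0, 0, v, 0) w' = 0.
  by move=> tw; rewrite /ep_form tw scale0r addr0 /= Ao mul0mx.
rewrite /lie_derivative derive_lorentz_field !eE//; last first.
  by rewrite /lorentz_field_diff /time /pos /= dotE !mxE !mulr0 addr0 oppr0.
rewrite /= /time /pos /vel /= !scale0r !subr0 !mulmx0 !addr0 !mxE addr0 => D0.
rewrite -[RHS]D0.
apply: eq_derive_line => h.
have -> : lorentz_field eta beta 0 (0, 0, v, 0) = (0, 0, u, 0).
  rewrite /lorentz_field /time/pos/vel/=; congr (_, _, _, _).
  - by rewrite dotE !mxE !mulr0 addr0 oppr0.
  - by rewrite !scale0r addr0.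
  - by rewrite bv scale0r addr0 subrK.
  - by rewrite scaler0 dotE !mxE !mulr0 addr0 !scale0r !addr0.
rewrite -[h *: (0, 0, u, 0) + _]/(_, _, _, _) -[h *: e_v R l + _]/(_, _, _) /=.
by rewrite /ep_form /entry /time /= scale0r -colE !mxE !addr0.
Qed.

End Stabilizer.

(** * Integration over the velocity domain *)

Lemma grad_coef v l : vdom eta v ->
  sq v * d l (0, 0, v) = - 3 * A (0, 0, v) 0 1 * (eta l * v l 0).
Proof.
(* The zeros of a are not yet excluded; at such points both sides vanish. *)
move=> dv; have [a0|a0] := eqVneq (A (0, 0, v) 0 1) 0.
  by rewrite derive_at_zero// a0 mulr0 mulr0 mul0r.
by have [d0 d1 _ _ _] := stabilizer_coef dv a0; case: (ord2P l) => ->.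
Qed.

(** By [grad_coef] the function a s^(3/2) has zero gradient; C is its value at 0, nonzero because A
    is not identically zero. Consequently a vanishes nowhere, and [stabilizer_coef] becomes
    available at every velocity. *)
Lemma coefA_unique : exists2 C : R, C != 0 &
  forall p, jet1_dom eta p -> A p = C *: coefA eta p.
Proof.
pose F (p : jet1 R) := entry A 0 1 p * sq (vel p) `^ (3 / 2).
have dA q : jet1_dom eta q -> differentiable (entry A 0 1) q.
  by move=> dq; exact: smooth_differentiable (ep_smoothA EP 0 1) dq.
have DF q w (dq : jet1_dom eta q) : has_derivative F q w _ :=
  has_derivativeM (conj (dA q dq) (erefl ('D_w (entry A 0 1) q)))
    (has_derivative_norm_powR (@linear_vel R) (@continuous_vel R) w (3 / 2) dq).
have FC := @const_on_vdom R eta F.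
have {}FC v : vdom eta v -> F (0, 0, v) = F (0, 0, 0).
  apply: FC => {}v; first by move=> dv; have [] := DF (0, 0, v) 0 dv.
  move=> i dv; rewrite /pv (DF (0, 0, v) (e_v R i) dv).2 /vel /= dot_delta.
  have := grad_coef i dv; rewrite /pv /entry /=.
  (* Splitting off one factor s brings out the product s grad a. *)
  have -> : (3 / 2 : R) = 1 / 2 + 1%:R by field.
  rewrite vdom_powR// expr1 addrK.
  move: ('D_(e_v R i) _ _) (A (0, 0, v) 0 1) (sq v) (sq v `^ (1 / 2)) (v i 0) (eta i).
  move=> g a s r x e H.
  transitivity (3 * a * r * e * x + r * (s * g)); first by field.
  by apply: (etrans (congr1 (fun z => 3 * a * r * e * x + r * z) H)); ring.
have AE p : jet1_dom eta p -> A p = F (0, 0, 0) *: coefA eta p.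
  case: p => [[t x] v] dv; have r0 : sq v `^ (3 / 2) != 0 by rewrite gt_eqF// powR_gt0.
  have a01 : A (t, x, v) 0 1 = F (0, 0, 0) * sq v `^ (- (3 / 2)).
    by rewrite -(FC v dv) /F (txA 0 1 0 t 0 x dv) /vel /= powRN mulfK.
  apply/matrixP => i j; rewrite /coefA /coefA_vel [RHS]mxE [X in _ = _ * X]mxE mulrA -a01.
  case: (ord2P i) => ->; case: (ord2P j) => ->;
    by rewrite levi_civitaE ?mulr0 ?mulr1 ?mulrN1 ?skew_diag// (skewE 0 1).
exists (F (0, 0, 0)) => //; apply/eqP => F0.
have [p [dp Ap]] := ep_neq0A EP; apply: Ap.
by rewrite AE// F0 scale0r.
Qed.

(** Pointwise B = F G with G = s^(-3/2) N. Both B and G are curl-free, so G_1l d_0 F = G_0l d_1 F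
    for l = 0, 1; as det G is nonzero, grad F = 0. *)
Lemma coefB_unique : exists mu0 : R,
  forall p, jet1_dom eta p -> B p = mu0 *: coefB eta (- 1) p.
Proof.
have [C C0 AE] := coefA_unique.
(* The value mu = -1 gives [G] a positive sign. *)
pose G i j := entry (coefB eta (- 1)) i j.
pose e := eta 0 * eta 1 / 2.
(* This is tr(adj(G) B) / (2 det G), where 1 / det G = eta_0 eta_1 s^2; written without division it
   is visibly smooth. *)
pose F (p : jet1 R) := (e * (B p 0 0 * G 1 1 p + B p 1 1 * G 0 0 p +
    - (2 * (B p 0 1 * G 0 1 p)))) * (sq (vel p) * sq (vel p)).
have oU := @open_jet1_dom R eta.
have sF : smooth (jet1_dom eta) F.
  have sB i j : smooth (jet1_dom eta) (fun p => B p i j) := ep_smoothB EP i j.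
  have sG i j : smooth (jet1_dom eta) (G i j) by exact: smooth_coefB.
  have sS : smooth (jet1_dom eta) (fun p => sq (vel p)).
    apply: smoothD => //; first exact: smooth_cst.
    exact: (smooth_dot eta (@linear_vel R) (@continuous_vel R)
      (@linear_vel R) (@continuous_vel R)).
  do ![exact: sB|exact: sG|exact: sS|apply: smoothN => //|apply: smoothD => //
      |apply: smoothM => //|exact: smooth_cst].
have dF p : jet1_dom eta p -> differentiable F p by exact: smooth_differentiable.
have BF p i j : jet1_dom eta p -> B p i j = F p * G i j p.
  case: p => [[t x] v] dv.
  have a0 : A (0, 0, v) 0 1 != 0.
    rewrite AE// /coefA /coefA_vel [X in X != _]mxE mulf_neq0// mxE mulf_neq0//.
      by rewrite gt_eqF// powR_gt0.
    by rewrite levi_civitaE oner_eq0.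
  have [_ _ _ _ H] := stabilizer_coef dv a0.
  have s0 : sq v != 0 by rewrite gt_eqF.
  have s3 : sq v `^ (- (3 / 2)) * sq v `^ (- (3 / 2)) = (sq v * sq v * sq v)^-1.
    rewrite -powRD; last by rewrite s0 implybT.
    have -> : - (3 / 2) - (3 / 2) = - 3%:R :> R by field.
    by rewrite powRN powR_mulrn ?ltW// exprSr expr2.
  have GE k l : G k l (t, x, v) = sq v `^ (- (3 / 2)) * proj eta v k l.
    by rewrite /G /entry /coefB /coefB_vel mxE opprK mul1r.
  have tE k l : B (0, 0, v) k l = B (t, x, v) k l := txB k l 0 t 0 x dv.
  have := H i j; rewrite /= /F /vel /= !GE !tE.
  move: s0 s3; rewrite /e.
  move: (sq v) (sq v `^ (- (3 / 2))) (proj eta v 1 1) (proj eta v 0 1)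
    (proj eta v 0 0) (proj eta v i j)
    (B (t, x, v) 0 0) (B (t, x, v) 0 1) (B (t, x, v) 1 1) (B (t, x, v) i j)
    (eta 0) (eta 1).
  move=> s r p11 p01 p00 pij b00 b01 b11 bij e0 e1 s0 s3 bE.
  transitivity (e0 * e1 * (b00 * p11 - 2 * b01 * p01 + b11 * p00) * pij * (r * r) * (s * s) / 2).
    by rewrite -bE s3; field.
  by field.
clearbody F.
have dG p i j : jet1_dom eta p -> differentiable (G i j) p.
  by move=> dp; have [] := has_derivative_coefB (- 1) 0 i j dp.
have pvB k i j v (dv : vdom eta v) : pv k (entry B i j) (0, 0, v) =
    F (0, 0, v) * pv k (G i j) (0, 0, v) + G i j (0, 0, v) * pv k F (0, 0, v).
  have dp : jet1_dom eta (0, 0, v) := dv.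
  have [_ <-] := has_derivativeM (conj (dF _ dp) (erefl ('D_(e_v R k) F (0, 0, v))))
    (conj (dG _ i j dp) (erefl ('D_(e_v R k) (G i j) (0, 0, v)))).
  by apply: near_eq_derive; apply: filterS (jet1_dom_near dp) => q; exact: BF.
(* Translation invariance removes the three terms in A from the third condition of (V). *)
have Bcurl l v : vdom eta v -> pv 0 (entry B 1 l) (0, 0, v) = pv 1 (entry B 0 l) (0, 0, v).
  move=> dv; have := variational_3 (ep_variational EP) (dv : jet1_dom eta (0, 0, v)) 0 1 l.
  rewrite (D1_tx_const (pv_tx_const l (txA 0 1)))// /alt2 !(px_tx_const _ (txA _ _))//.
  move: (pv 0 (entry B 1 l) _) (pv 1 (entry B 0 l) _) => b0 b1 H; lra.
have Gcurl l v : vdom eta v -> pv 0 (G 1 l) (0, 0, v) = pv 1 (G 0 l) (0, 0, v).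
  move=> dv; rewrite /pv /G !(has_derivative_coefB (- 1) _ _ _ (dv : jet1_dom eta (0, 0, v))).2.
  rewrite /vel /= !dot_delta /proj !mxE /= !dotE.
  by case: (ord2P l) => ->; case: (heta 0) => ->; case: (heta 1) => -> /=; ring.
have Gdet v : vdom eta v ->
    G 0 0 (0, 0, v) * G 1 1 (0, 0, v) - G 0 1 (0, 0, v) * G 1 0 (0, 0, v) != 0.
  move=> dv; have s0 : sq v != 0 by rewrite gt_eqF.
  have GE k l : G k l (0, 0, v) = sq v `^ (- (3 / 2)) * proj eta v k l.
    by rewrite /G /entry /coefB /coefB_vel mxE opprK mul1r.
  have -> : G 0 0 (0, 0, v) * G 1 1 (0, 0, v) - G 0 1 (0, 0, v) * G 1 0 (0, 0, v) =
      sq v `^ (- (3 / 2)) ^+ 2 * (eta 0 * eta 1 * sq v).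
    rewrite !GE /proj !mxE /= !dotE; move: (_ `^ _) => r.
    by case: (heta 0) => ->; case: (heta 1) => ->; ring.
  have en i : eta i != 0 by case: (heta i) => ->; rewrite ?oppr_eq0 oner_eq0.
  have r0 : sq v `^ (- (3 / 2)) != 0 by rewrite gt_eqF// powR_gt0.
  by rewrite expr2 !mulf_neq0.
have F0 v k : vdom eta v -> pv k F (0, 0, v) = 0.
  move=> dv.
  have H l : G 1 l (0, 0, v) * pv 0 F (0, 0, v) = G 0 l (0, 0, v) * pv 1 F (0, 0, v).
    have := Bcurl l v dv; rewrite (pvB 0 1 l v dv) (pvB 1 0 l v dv) (Gcurl l v dv).
    exact: addrI.
  apply: (mulfI (Gdet v dv)); rewrite mulr0.
  move: (H 0) (H 1); case: (ord2P k) => ->.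
    move: (pv 0 F _) (pv 1 F _) (G 0 0 _) (G 0 1 _) (G 1 0 _) (G 1 1 _)
      => f0 f1 g00 g01 g10 g11 H0 H1.
    by transitivity (g00 * (g11 * f0) - g01 * (g10 * f0)); [ring | rewrite H0 H1; ring].
  move: (pv 0 F _) (pv 1 F _) (G 0 0 _) (G 0 1 _) (G 1 0 _) (G 1 1 _)
      => f0 f1 g00 g01 g10 g11 H0 H1.
  by transitivity (g11 * (g00 * f1) - g10 * (g01 * f1)); [ring | rewrite -H0 -H1; ring].
exists (F (0, 0, 0)) => -[[t x] v] dv.
have FC := const_on_vdom (fun u du => dF (0, 0, u) du) (fun u i du => F0 u i du) dv.
apply/matrixP => i j; rewrite [RHS]mxE -FC.
transitivity (F (0, 0, v) * G i j (0, 0, v)) => //.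
by rewrite -BF//; exact: (txB i j).
Qed.

Lemma c_unique p : jet1_dom eta p -> c p = 0.
Proof.
have [C C0 AE] := coefA_unique.
case: p => [[t x] v] dv.
have a0 : A (0, 0, v) 0 1 != 0.
  rewrite AE// /coefA /coefA_vel [X in X != _]mxE mulf_neq0// mxE mulf_neq0//.
    by rewrite gt_eqF// powR_gt0.
  by rewrite levi_civitaE oner_eq0.
have [_ _ c0 c1 _] := stabilizer_coef dv a0.
by rewrite (tx_c t 0 x 0 dv); apply: colP2; rewrite [RHS]mxE.
Qed.

End Uniqueness.

(** * Both directions of the classification assembled *)

Theorem proposition2 (R : realType) (eta : 'I_2 -> R)
    (heta : forall i, eta i = 1 \/ eta i = -1) :
  (forall (A B : jet1 R -> 'M[R]_2) (c : jet1 R -> 'cV[R]_2),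
     euler_poisson eta A B c ->
     poincare_invariant eta A B c ->
     exists C mu : R, C != 0 /\
       forall (p : jet2 R) (v'' : 'cV[R]_2), jet2_dom eta p ->
         ep_lhs A B c p v'' = C *: invariant_lhs eta mu (vel p.1) p.2 v'') /\
  (forall mu : R,
     exists (A B : jet1 R -> 'M[R]_2) (c : jet1 R -> 'cV[R]_2),
       [/\ euler_poisson eta A B c,
           poincare_invariant eta A B c &
           forall (p : jet2 R) (v'' : 'cV[R]_2), jet2_dom eta p ->
             ep_lhs A B c p v'' = invariant_lhs eta mu (vel p.1) p.2 v'']).
Proof.
split=> [A B c EP PI|mu]; last first.
  exists (coefA eta), (coefB eta mu), (@coefc R); split.
  - exact: euler_poisson_coef.
  - exact: poincare_invariant_coef.
  - by move=> p v''; exact: ep_lhs_coef.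
have [C C0 AE] := coefA_unique heta EP PI.
have [m BE] := coefB_unique heta EP PI.
(* B is m s^(-3/2) N, while C times the invariant B is - C mu s^(-3/2) N; hence mu = - m / C. *)
exists C, (- m / C); split=> // p v'' dp.
rewrite -ep_lhs_coef// /ep_lhs !scalerDr -!scalemxAl.
have dq : jet1_dom eta p.1 := dp.
(* The equality A = C [coefA] on the open domain passes to velocity derivatives. *)
have -> : dA_along A p = C *: dA_along (coefA eta) p.
  apply/matrixP => i j; rewrite !mxE big_distrr; apply: eq_bigr => l _ /=.
  rewrite mulrCA; congr (_ * _).
  have [DA _] := has_derivative_coefA (e_v R l) i j dq.
  have [_ D] := has_derivativeM (has_derivative_cst C p.1 (e_v R l))
    (conj DA (erefl ('D_(e_v R l) (entry (coefA eta) i j) p.1))).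
  rewrite mulr0 addr0 in D; rewrite /pv -D; apply: near_eq_derive.
  by apply: filterS (jet1_dom_near dq) => q dq'; rewrite /entry AE// mxE.
have -> : B p.1 = C *: coefB eta (- m / C) p.1.
  rewrite BE// /coefB /coefB_vel !scalerA; congr (_ *: _).
  by move: (_ `^ _) => r; field.
by rewrite AE// (c_unique heta EP PI)// scaler0 -!scalemxAl.
Qed.
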